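(* In the extra-special case: (i) The map $\tau:W^0\to\mathrm{AN}(\Delta(1))$, $\tau(w)=\Gamma_w:=\min(\Delta(1)\setminus N(w))$, is surjective, $I(\Gamma_w)=\Delta(1)\setminus N(w)$, and $\#\tau^{-1}(\Gamma_w)=1$ if the upper ideal $I(\Gamma_w)$ is not Lagrangian, while $\#\tau^{-1}(\Gamma_w)=2$ if $I(\Gamma_w)$ is Lagrangian. (ii) For $w\in W^0$, the following are equivalent: the upper ideal $I_w:=\Delta(1)\setminus N(w)$ is Lagrangian; $w(\theta)\in\Pi_l\cup(-\Pi_l)$; $\tau^{-1}(\Gamma_w)=\{w,ws_\theta\}$. In particular, $\#\mathrm{AN}(\Delta(1))=\#W^0-\#\Pi_l=(h-1)\cdot\#\Pi_l$.
   Context: Let $\mathfrak g$ be a complex simple Lie algebra with root system $\Delta$ in a real Euclidean space with $W$-invariant inner product $(\,,\,)$, positive roots $\Delta^+$, simple roots $\Pi$, Weyl group $W$, Coxeter number $h$, highest root $\theta$, $\theta^\vee=2\theta/(\theta,\theta)$; $s_\theta\in W$ is the reflection in $\theta$. $\Pi_l$ is the set of simple roots of the same length as $\theta$ (all simple roots if all roots have the same length). Extra-special case: $\Delta(j)=\{\gamma\in\Delta:(\gamma,\theta^\vee)=j\}$, so $\Delta(2)=\{\theta\}$ and $\Delta^+=\Delta(0)^+\sqcup\Delta(1)\sqcup\{\theta\}$ with $\Delta(0)^+=\Delta(0)\cap\Delta^+$; $\Pi(0)=\Pi\cap\Delta(0)$. $\Delta(1)$ is partially ordered by $\mu\preccurlyeq\gamma$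 iff $\gamma-\mu$ is a nonnegative integer combination of $\Pi(0)$; $\mathrm{AN}(\Delta(1))$ is its set of antichains, $I(\Gamma)$ is the upper ideal generated by $\Gamma$, and $\min$ denotes the set of minimal elements. $W^0=\{w\in W:w(\alpha)\in\Delta^+\ \forall\alpha\in\Delta(0)^+\}$; $N(w)=\{\gamma\in\Delta^+:w(\gamma)\in-\Delta^+\}$. A subset $S\subset\Delta(1)$ is Lagrangian if $\#S=\frac12\#\Delta(1)$ and there are no $\gamma_1,\gamma_2\in S$ with $\gamma_1+\gamma_2=\theta$. *)

(* Defs.v *)
From mathcomp Require Import all_boot all_order all_algebra all_fingroup.
From mathcomp Require Import sesquilinear finmap boolp reals.

Set Implicit Arguments.
Unset Strict Implicit.
Unset Printing Implicit Defensive.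

Import Order.TTheory GRing.Theory Num.Theory.

Local Open Scope ring_scope.

(* A complex simple Lie algebra enters only through its root system, an       *)
(* irreducible reduced crystallographic root system spanning a real Euclidean *)
(* space V with inner product ip. As reflections are taken with respect to    *)
(* ip, invariance of ip under the Weyl group is automatic.                    *)

Section Reflection.
Context {R : realType} {V : vectType R} (ip : {dot V for idfun}).

Definition coroot (a : V) : V := (2 / ip a a) *: a.

Definition reflection (a v : V) : V := v - ip v (coroot a) *: a.

Lemma reflectionK (a : V) : a != 0 -> involutive (reflection a).
Proof.
move=> a0 v; rewrite /reflection /coroot.
have aa0 : ip a a != 0 by rewrite gt_eqF// neq0_dnorm_gt0.
rewrite linearBl linearZl_LR /= [ip a (_ *: _)]linearZr_LR /= divfK//.
set c := ip v _.
by rewrite -addrA -opprD -scalerDl mulr_natr mulr2n addrA subrr scale0r subr0.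
Qed.

Record rootSystem := RootSystem {
  roots :> {fset V};
  roots_span : <<roots>>%VS = fullv;
  roots_neq0 : forall a, a \in roots -> a != 0;
  roots_reflection :
    forall a b, a \in roots -> b \in roots -> reflection a b \in roots;
  roots_crystallographic :
    forall a b, a \in roots -> b \in roots -> ip b (coroot a) \is a Num.int;
  roots_reduced :
    forall a (c : R), a \in roots -> c *: a \in roots -> c = 1 \/ c = -1 }.

End Reflection.

Section RootSystem.
Context {R : realType} {V : vectType R} {ip : {dot V for idfun}}.
Variable Phi : rootSystem ip.

Definition root_type : finType := roots Phi.

Definition irreducible : Prop :=
  roots Phi != fset0 /\
  forall S : {set root_type}, S != set0 ->
    (forall a b : root_type, a \in S -> b \notin S -> ip (val a) (val b) = 0) ->
    S = setT.

Definition root_reflection (a b : root_type) : root_type :=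
  [` roots_reflection (valP a) (valP b)]%fset.

Lemma root_reflection_inj (a : root_type) : injective (root_reflection a).
Proof.
move=> b c /(congr1 val) /= /(congr1 (reflection ip (val a))).
by rewrite !reflectionK ?(roots_neq0 (valP a))// => /val_inj.
Qed.

Definition root_perm (a : root_type) : {perm root_type} := perm (@root_reflection_inj a).

(* The Weyl group is represented by its action on the roots, which is         *)
(* faithful since the roots span V. Permutations compose from left to right:  *)
(* (u * v) a = v (u a), so the product written w s in function notation is    *)
(* s * w here.                                                                *)
Definition weyl : {group {perm root_type}} := <<[set root_perm a | a : root_type]>>%G.

Definition oppset (S : {set root_type}) : {set root_type} :=
  [set a | [exists b in S, val a == - val b]].

Definition nat_comb (S : {set root_type}) (v : V) : Prop :=
  exists k : root_type -> nat, v = \sum_(a in S) val a *+ k a.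

(* Pi is a system of simple roots. *)
Definition is_base (Pi : {set root_type}) : Prop :=
  free [seq val a | a <- enum Pi] /\
  forall a : root_type, nat_comb Pi (val a) \/ nat_comb Pi (- val a).

Section Base.
Variable Pi : {set root_type}.

Definition pos_roots : {set root_type} := [set a | `[< nat_comb Pi (val a) >]].

Definition is_highest_root (theta : root_type) : Prop :=
  forall a : root_type, nat_comb Pi (val theta - val a).

(* The order of a Coxeter element. The simple reflections are multiplied in   *)
(* the order of enum Pi; other orders give conjugate elements.                *)
Definition coxeter_number : nat := #[\prod_(a in Pi) root_perm a]%g.

Variable theta : root_type.

Definition long_simple : {set root_type} :=
  [set a in Pi | ip (val a) (val a) == ip (val theta) (val theta)].

Definition Delta (j : int) : {set root_type} :=
  [set a | ip (val a) (coroot ip (val theta)) == j%:~R].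

Definition Delta0_pos : {set root_type} := Delta 0 :&: pos_roots.

Definition Pi0 : {set root_type} := Pi :&: Delta 0.

Definition prec (m g : root_type) : bool := `[< nat_comb Pi0 (val g - val m) >].

Definition antichains : {set {set root_type}} :=
  [set G : {set root_type} | (G \subset Delta 1) &&
    [forall m in G, forall g in G, prec m g ==> (m == g)]].

Definition upper_ideal (G : {set root_type}) : {set root_type} :=
  [set g in Delta 1 | [exists m in G, prec m g]].

Definition min_elts (S : {set root_type}) : {set root_type} :=
  [set m in S | [forall g in S, prec g m ==> (g == m)]].

Definition lagrangian (S : {set root_type}) : bool :=
  [&& S \subset Delta 1, #|S|.*2 == #|Delta 1| &
      ~~ [exists g1 in S, exists g2 in S, val g1 + val g2 == val theta]].

Definition W0 : {set {perm root_type}} :=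
  [set w in weyl | [forall a in Delta0_pos, w a \in pos_roots]].

Definition inversions (w : {perm root_type}) : {set root_type} :=
  [set g in pos_roots | w g \in oppset pos_roots].

Definition tau (w : {perm root_type}) : {set root_type} :=
  min_elts (Delta 1 :\: inversions w).

Definition tau_fiber (G : {set root_type}) : {set {perm root_type}} :=
  [set w in W0 | tau w == G].

End Base.
End RootSystem.

(* Main.v *)
Require Import Defs.
From mathcomp Require Import all_boot all_order all_algebra all_fingroup.
From mathcomp Require Import sesquilinear finmap boolp reals.
From mathcomp Require Import cyclic ring lra.

(* An element w of W^0 is determined by N(w), which lies in Delta(1) + {theta}, *)
(* hence by the ideal I_w and the sign of w(theta). The roots of Delta(1) are  *)
(* paired by g <-> theta - g; a pair inside I_w makes w(theta) positive and a  *)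
(* pair outside I_w makes it negative, so both signs can occur only if I_w     *)
(* picks one root of each pair, i.e. is Lagrangian, and then w and w s_theta   *)
(* share the same ideal. For an ideal I, one of Delta(1) - I and               *)
(* (Delta(1) - I) + {theta} is closed and co-closed, hence is some N(w), which *)
(* gives surjectivity. Pairs on which w is positive (or negative) correspond   *)
(* to writing w(theta) (or its opposite) as a sum of two positive roots, so    *)
(* I_w is Lagrangian iff w(theta) is simple up to sign. As w |-> w(theta) is a *)
(* bijection from W^0 to the long roots, this counts the antichains.           *)
(*                                                                             *)
(* It remains to see that there are h #Pi_l long roots, h being the order of   *)
(* the Coxeter element c. The positive roots made negative by c are multiples  *)
(* d_a of om_a - c^-1 om_a, for the fundamental weights om_a, and each c-orbit *)
(* of roots contains some d_a, since its sum, fixed by c, is zero. As 1 - c is *)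
(* injective, c^k d_a = d_b (same lengths) forces c^k om_a = om_b, so a = b.   *)
(* Finally, an element of the centralizer of c fixing om_a fixes om_b for the  *)
(* neighbors b of a, hence for all b by connectedness, so that it is trivial:  *)
(* all c-orbits of roots have size h and contain exactly one d_a.              *)

Set Implicit Arguments.
Unset Strict Implicit.
Unset Printing Implicit Defensive.

Import Order.TTheory GRing.Theory Num.Theory.

Local Open Scope ring_scope.

(** The sign of w(theta) is the only datum that the ideal of [w] can miss. Weyl group elements are
    separated by their inversions ([inversions_inj]), and every closed and co-closed set of positive
    roots is an inversion set ([biclosed_inversions]). For w in W^0 the inversions have level 1 or
    2, so the ideal and the sign of w(theta) determine [w] ([W0_inj]). As theta = g + (theta - g), a
    pair on which w has constant sign fixes that sign ([not_lagrangian_sign]); without such a pair,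
    s_theta exchanges the two solutions. Surjectivity ([tau_surj]) rests on [ideal_pair_exclusion]:
    an upper ideal cannot contain one complementary pair and miss another, so theta can be
    consistently added to, or left out of, its complement.

    Decompositions of w(theta) into two positive roots pull back to pairs of level one, whence
    [lagrangian_iff]. With W^0 in bijection with the long roots ([W0_theta_inj], [W0_theta_surj]),
    the fiber sizes give [card_antichains]. The factor h comes from [coxeter_number_long]: the
    Coxeter element acts freely on the long roots, with one orbit for each long simple root. *)

Section RootSystemTheory.
Context {R : realType} {V : vectType R} {ip : {dot V for idfun}}.
Context {Phi : rootSystem ip} {Pi : {set root_type Phi}}.
Hypothesis Pi_base : is_base Pi.

Local Notation T := (root_type Phi).
Local Notation pos := (pos_roots Pi).
Local Notation sigma := (@root_perm R V ip Phi).
Local Notation W := (weyl Phi).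
Local Notation N := (inversions Pi).
Implicit Types (a b c g : T) (u v : V) (w x y : {perm T}) (s : seq T).

(** * The inner product and reflections *)

Lemma ipDl u1 u2 v : ip (u1 + u2) v = ip u1 v + ip u2 v.
Proof. exact: linearDl. Qed.
Lemma ipDr u v1 v2 : ip u (v1 + v2) = ip u v1 + ip u v2.
Proof. exact: linearDr. Qed.
Lemma ipNl u v : ip (- u) v = - ip u v.
Proof. exact: linearNl. Qed.
Lemma ipNr u v : ip u (- v) = - ip u v.
Proof. exact: linearNr. Qed.
Lemma ipBl u1 u2 v : ip (u1 - u2) v = ip u1 v - ip u2 v.
Proof. exact: linearBl. Qed.
Lemma ipBr u v1 v2 : ip u (v1 - v2) = ip u v1 - ip u v2.
Proof. exact: linearBr. Qed.
Lemma ipZl k u v : ip (k *: u) v = k * ip u v.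
Proof. exact: linearZl_LR. Qed.
Lemma ipZr k u v : ip u (k *: v) = k * ip u v.
Proof. exact: linearZr_LR. Qed.
Lemma ip0l v : ip 0 v = 0.
Proof. exact: linear0l. Qed.
Lemma ip_suml I (r : seq I) (P : pred I) (E : I -> V) v :
  ip (\sum_(i <- r | P i) E i) v = \sum_(i <- r | P i) ip (E i) v.
Proof. exact: linear_sumlz. Qed.
Lemma ip_sumr I (r : seq I) (P : pred I) (E : I -> V) v :
  ip v (\sum_(i <- r | P i) E i) = \sum_(i <- r | P i) ip v (E i).
Proof. exact: linear_sumr. Qed.
Lemma ipC u v : ip u v = ip v u.
Proof. by rewrite hermC expr0 mul1r. Qed.
Lemma ip_ge0 v : 0 <= ip v v.
Proof.
have [->|v0] := eqVneq v 0; first by rewrite ip0l.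
by rewrite ltW// neq0_dnorm_gt0.
Qed.
Lemma ip_eq0 v : ip v v = 0 -> v = 0.
Proof.
have [->//|v0] := eqVneq v 0; move=> h.
by have := neq0_dnorm_gt0 (s := ip) _ v0; rewrite h ltxx.
Qed.

Lemma root_neq0 a : val a != 0.
Proof. exact: roots_neq0 (valP a). Qed.

Lemma root_gt0 a : 0 < ip (val a) (val a).
Proof. exact: neq0_dnorm_gt0 _ (root_neq0 a). Qed.

Lemma ip_coroot v a : ip v (coroot ip (val a)) = 2 * ip v (val a) / ip (val a) (val a).
Proof. by rewrite /coroot ipZr mulrAC. Qed.

Lemma val_sigma a b :
  val (sigma a b) = val b - ip (val b) (coroot ip (val a)) *: val a.
Proof. by rewrite permE. Qed.

(** * Coordinates with respect to the simple roots *)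

(** The Gram matrix of the simple roots is invertible: a kernel vector gives a combination of simple
    roots orthogonal to itself, hence zero, and freeness kills its coefficients. The rows of the
    inverse are the coordinates of the dual basis. *)
Lemma dual_basis_ex : exists om : T -> V,
  {in Pi &, forall a b, ip (om a) (val b) = (a == b)%:R}.
Proof.
pose B (i : 'I_#|Pi|) : V := val (enum_val i).
pose G := \matrix_(i, j) ip (B i) (B j).
have Gu : G \in unitmx.
  rewrite -row_free_unit; apply: inj_row_free => x xG.
  pose v := \sum_i x 0 i *: B i.
  have vB j : ip v (B j) = 0.
    move/matrixP/(_ 0 j): xG; rewrite !mxE => xG; rewrite ip_suml -[RHS]xG.
    by apply: eq_bigr => i _; rewrite ipZl mxE.
  have v0 : v = 0.
    by apply: ip_eq0; rewrite {2}/v ip_sumr big1// => i _; rewrite ipZr vB mulr0.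
  have [Pi_free _] := Pi_base.
  have sz : size [seq val a | a <- enum Pi] = #|Pi| by rewrite size_map cardE.
  have /freeP fr : free (Tuple (introT eqP sz)) by [].
  apply/rowP => i; rewrite mxE; apply: (fr (fun i => x 0 i)).
  rewrite -[RHS]v0; apply: eq_bigr => j _; rewrite /= /B (enum_val_nth (enum_val j)).
  by rewrite (nth_map (enum_val j))// -cardE.
have /boolp.choice[om omP] : forall a, exists v : V,
    a \in Pi -> {in Pi, forall b, ip v (val b) = (a == b)%:R}.
  move=> a; have [aPi|] := boolP (a \in Pi); last by exists 0.
  pose i := enum_rank_in aPi a.
  exists (\sum_j (invmx G i j) *: B j) => _ b bPi.
  rewrite ip_suml.
  have := mulVmx Gu => /matrixP/(_ i (enum_rank_in aPi b)); rewrite !mxE => e.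
  transitivity ((i == enum_rank_in aPi b)%:R : R).
    rewrite -e; apply: eq_bigr => j _; rewrite ipZl !mxE /B.
    by rewrite (enum_rankK_in aPi bPi).
  congr (_%:R); congr nat_of_bool; apply/eqP/eqP => [|<-//].
  by move/(congr1 enum_val); rewrite !enum_rankK_in.
by exists om => a b aPi bPi; exact: omP.
Qed.

(* Up to positive factors, the fundamental weights. *)
Definition om : T -> V := sval (cid dual_basis_ex).

Lemma om_val a b : a \in Pi -> b \in Pi -> ip (val b) (om a) = (a == b)%:R.
Proof. by move=> aPi bPi; rewrite ipC /om; case: cid => /= f ->. Qed.

Lemma val_nat_comb_om (S : {set T}) v : S \subset Pi -> nat_comb S v ->
  v = \sum_(b in Pi) ip v (om b) *: val b.
Proof.
move=> SPi [k ->].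
have e b : b \in Pi -> ip (\sum_(a in S) val a *+ k a) (om b) = (if b \in S then k b else 0%N)%:R.
  move=> bPi; rewrite ip_suml; case: ifPn => [bS|bS].
    rewrite (bigD1 b)//= big1 => [|c /andP[cS cb]].
      by rewrite addr0 -scaler_nat ipZl om_val// eqxx mulr1.
    by rewrite -scaler_nat ipZl om_val ?(subsetP SPi)// eq_sym (negbTE cb) mulr0.
  apply: big1 => c cS; rewrite -scaler_nat ipZl om_val//; last exact: (subsetP SPi).
  by case: eqP bS => [->|_ _]; rewrite ?cS// mulr0.
transitivity (\sum_(b in Pi) if b \in S then val b *+ k b else 0 : V).
  rewrite -big_mkcondr; apply: eq_bigl => b /=.
  by apply/idP/andP => [bS|[]//]; rewrite (subsetP SPi).
by apply: eq_bigr => b bPi; rewrite e//; case: ifP => _; rewrite ?scale0r// scaler_nat.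
Qed.

Lemma om_expand v : v = \sum_(b in Pi) ip v (om b) *: val b.
Proof.
have root_expand a : val a = \sum_(b in Pi) ip (val a) (om b) *: val b.
  have [_ /(_ a)[|]] := Pi_base; first exact: val_nat_comb_om.
  move/(val_nat_comb_om (subxx Pi))/(congr1 -%R).
  rewrite opprK -sumrN => {1}->.
  by apply: eq_bigr => b _; rewrite ipNl scaleNr opprK.
have : v \in <<Defs.roots Phi>>%VS by rewrite roots_span memvf.
set X := in_tuple (Defs.roots Phi : seq V) => /(@coord_span _ _ _ X) ->.
set k := coord X ^~ v.
transitivity (\sum_i k i *: \sum_(b in Pi) ip X`_i (om b) *: val b : V); last first.
  under eq_bigr do rewrite scaler_sumr.
  rewrite exchange_big/=; apply: eq_bigr => b _; rewrite ip_suml scaler_suml.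
  by apply: eq_bigr => i _; rewrite ipZl scalerA.
apply: eq_bigr => i _; congr (_ *: _).
have Xi : X`_i \in Defs.roots Phi by exact: mem_nth.
exact: root_expand [` Xi]%fset.
Qed.

Lemma om_inj v : {in Pi, forall b, ip v (om b) = 0} -> v = 0.
Proof. by move=> h; rewrite [v]om_expand big1// => b /h->; rewrite scale0r. Qed.

Lemma ip_expand u v : ip u v = \sum_(b in Pi) ip u (om b) * ip (val b) v.
Proof. by rewrite {1}[u]om_expand ip_suml; apply: eq_bigr => b _; rewrite ipZl. Qed.

Lemma ip_simple_inj v : {in Pi, forall b, ip v (val b) = 0} -> v = 0.
Proof.
move=> h; apply: ip_eq0; rewrite ip_expand big1// => b bPi.
by rewrite [ip (val b) _]ipC h// mulr0.
Qed.

(** The real cone spanned by the simple roots. It replaces natural combinations, so that positivity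
    becomes a sign test on coordinates. *)
Definition cone v : bool := [forall b in Pi, 0 <= ip v (om b)].

Lemma coneP v : reflect {in Pi, forall b, 0 <= ip v (om b)} (cone v).
Proof. exact: forall_inP. Qed.

Lemma coneD u v : cone u -> cone v -> cone (u + v).
Proof.
by move=> /coneP hu /coneP hv; apply/coneP => b bPi; rewrite ipDl addr_ge0 ?hu ?hv.
Qed.

Lemma coneZ k v : 0 <= k -> cone v -> cone (k *: v).
Proof. by move=> k0 /coneP hv; apply/coneP => b bPi; rewrite ipZl mulr_ge0 ?hv. Qed.

Lemma cone0 : cone 0.
Proof. by apply/coneP => b _; rewrite ip0l. Qed.

Lemma cone_sum I (r : seq I) (P : pred I) (E : I -> V) :
  (forall i, P i -> cone (E i)) -> cone (\sum_(i <- r | P i) E i).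
Proof. by move=> h; elim/big_ind : _ => //; [exact: cone0|exact: coneD]. Qed.

Lemma cone_anti v : cone v -> cone (- v) -> v = 0.
Proof.
move=> /coneP h /coneP h'; apply: om_inj => b bPi; apply/eqP.
by rewrite eq_le h// andbT -oppr_ge0 -ipNl h'.
Qed.

Lemma nat_comb_cone (S : {set T}) v : S \subset Pi -> nat_comb S v -> cone v.
Proof.
move=> SPi [k ->]; apply: cone_sum => b bS; rewrite -scaler_nat; apply: coneZ => //.
by apply/coneP => c cPi; rewrite om_val ?ler0n//; exact: (subsetP SPi).
Qed.

(** Real nonnegative coordinates suffice for a root: it or its opposite is a natural combination,
    and the cone is pointed. *)
Lemma posE a : (a \in pos) = cone (val a).
Proof.
rewrite inE; apply/asboolP/idP => [|ha]; first exact: nat_comb_cone.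
have [_ /(_ a)[//|/(nat_comb_cone (subxx _))/(cone_anti ha)/eqP]] := Pi_base.
by rewrite (negbTE (root_neq0 a)).
Qed.

Lemma negE a : (a \notin pos) = cone (- val a).
Proof.
rewrite posE; have [_ /(_ a)[/(nat_comb_cone (subxx _))|/(nat_comb_cone (subxx _))]] := Pi_base.
  move=> h; rewrite h; apply/esym/negbTE/negP => /(cone_anti h)/eqP.
  by rewrite (negbTE (root_neq0 a)).
move=> h; rewrite h; apply/negP => /cone_anti/(_ h)/eqP.
by rewrite (negbTE (root_neq0 a)).
Qed.

(** The reflection of a root in itself is its opposite; this form yields an element of [T] at
    once. *)
Definition opp a : T := sigma a a.

Lemma val_opp a : val (opp a) = - val a.
Proof.
rewrite val_sigma ip_coroot mulfK ?gt_eqF ?root_gt0// -{1}(scale1r (val a)).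
by rewrite -scalerBl (_ : 1 - 2 = -1) ?scaleN1r//; lra.
Qed.

Lemma oppK : involutive opp.
Proof. by move=> a; apply: val_inj; rewrite !val_opp opprK. Qed.

Lemma pos_opp a : (opp a \in pos) = (a \notin pos).
Proof. by rewrite posE negE val_opp. Qed.

Lemma mem_oppset (S : {set T}) a : (a \in oppset S) = (opp a \in S).
Proof.
rewrite inE; apply/exists_inP/idP => [[b bS /eqP e]|aS].
  by rewrite (_ : opp a = b)//; apply: val_inj; rewrite val_opp e opprK.
by exists (opp a); rewrite ?aS// val_opp opprK.
Qed.

Lemma in_inversions w a : (a \in N w) = (a \in pos) && (w a \notin pos).
Proof. by rewrite [LHS]inE mem_oppset pos_opp. Qed.

Lemma simple_pos a : a \in Pi -> a \in pos.
Proof. by move=> aPi; rewrite posE; apply/coneP => b bPi; rewrite om_val ?ler0n. Qed.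

(** * The Weyl group acting on V *)

(* A linear map for every permutation [w]; it extends [w], and is an isometry,  *)
(* only for [w] in the Weyl group.                                            *)
Definition act w v : V := \sum_(b in Pi) ip v (om b) *: val (w b).

Lemma actD w u v : act w (u + v) = act w u + act w v.
Proof. by rewrite -big_split; apply: eq_bigr => b _; rewrite ipDl scalerDl. Qed.

Lemma actZ w k v : act w (k *: v) = k *: act w v.
Proof. by rewrite scaler_sumr; apply: eq_bigr => b _; rewrite ipZl scalerA. Qed.

Lemma act0 w : act w 0 = 0.
Proof. by have := actZ w 0 0; rewrite !scale0r. Qed.

Lemma actN w v : act w (- v) = - act w v.
Proof. by rewrite -!scaleN1r actZ. Qed.

Lemma actB w u v : act w (u - v) = act w u - act w v.
Proof. by rewrite actD actN. Qed.

Lemma act_sum w I (r : seq I) (P : pred I) (E : I -> V) :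
  act w (\sum_(i <- r | P i) E i) = \sum_(i <- r | P i) act w (E i).
Proof. exact: (big_morph _ (actD w) (act0 w)). Qed.

Lemma act_sigma a v : act (sigma a) v = v - ip v (coroot ip (val a)) *: val a.
Proof.
rewrite {2 3}[v]om_expand ip_suml scaler_suml -sumrB.
by apply: eq_bigr => b _; rewrite val_sigma scalerBr ipZl scalerA.
Qed.

Lemma ip_act_sigma a u v : ip (act (sigma a) u) (act (sigma a) v) = ip u v.
Proof.
rewrite !act_sigma !ip_coroot !ipBl !ipBr !ipZl !ipZr [ip (val a) v]ipC.
have := root_gt0 a; set A := ip _ _; set x := ip u _; set y := ip v _ => A0.
by field; rewrite gt_eqF.
Qed.

(** The elements satisfying [Q] form a subgroup containing the generators; in a finite group,
    closure under products gives inverses. *)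
Lemma weyl_ind (Q : {perm T} -> Prop) :
  Q 1%g -> (forall a, Q (sigma a)) ->
  (forall x y, x \in W -> y \in W -> Q x -> Q y -> Q (x * y)%g) ->
  forall w, w \in W -> Q w.
Proof.
move=> Q1 Qs QM w.
have grp : group_set [set w in W | `[< Q w >]].
  apply/group_setP; split; first by rewrite inE group1; exact/asboolP.
  move=> x y; rewrite !inE => /andP[xW /asboolP xQ] /andP[yW /asboolP yQ].
  by rewrite groupM//=; exact/asboolP/QM.
suff: W \subset Group grp by move/subsetP/(_ w) => h /h; rewrite inE => /andP[_ /asboolP].
rewrite gen_subG; apply/subsetP => _ /imsetP[a _ ->].
by rewrite inE mem_gen ?imset_f//=; exact/asboolP.
Qed.

Lemma act_val w a : w \in W -> act w (val a) = val (w a).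
Proof.
move=> wW; move: a; move: w wW; apply: weyl_ind => [a|a b|x y _ _ hx hy a].
- by rewrite perm1 [RHS]om_expand; apply: eq_bigr => b _; rewrite perm1.
- by rewrite act_sigma val_sigma.
rewrite permM -hy -hx act_sum; apply: eq_bigr => b _.
by rewrite actZ hy permM.
Qed.

Lemma act1 v : act 1%g v = v.
Proof. by rewrite [RHS]om_expand; apply: eq_bigr => b _; rewrite perm1. Qed.

Lemma actM x y v : y \in W -> act (x * y)%g v = act y (act x v).
Proof. by move=> yW; rewrite act_sum; apply: eq_bigr => b _; rewrite actZ act_val// permM. Qed.

Lemma ip_act w u v : w \in W -> ip (act w u) (act w v) = ip u v.
Proof.
move=> wW; move: u v; move: w wW; apply: weyl_ind => [u v|a u v|x y _ yW hx hy u v].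
- by rewrite !act1.
- exact: ip_act_sigma.
- by rewrite !actM// hy hx.
Qed.

Lemma actK w : w \in W -> cancel (act w) (act w^-1%g).
Proof. by move=> wW v; rewrite -actM ?groupV// mulgV act1. Qed.

Lemma actVK w : w \in W -> cancel (act w^-1%g) (act w).
Proof. by move=> wW v; rewrite -actM// mulVg act1. Qed.

Lemma ip_root w a b : w \in W -> ip (val (w a)) (val (w b)) = ip (val a) (val b).
Proof. by move=> wW; rewrite -!act_val// ip_act. Qed.

Lemma sigmaW a : sigma a \in W.
Proof. exact/mem_gen/imset_f. Qed.

Lemma sigma2 a : (sigma a * sigma a = 1)%g.
Proof.
apply/permP => b; rewrite permM perm1; apply: val_inj; rewrite !permE.
by apply: reflectionK; exact: root_neq0.
Qed.

Lemma sigmaK a : involutive (sigma a).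
Proof. by move=> b; rewrite -permM sigma2 perm1. Qed.

Lemma sigmaV a : ((sigma a)^-1 = sigma a)%g.
Proof. by apply/eqP; rewrite eq_invg_mul sigma2. Qed.

Lemma weyl_opp w a : w \in W -> w (opp a) = opp (w a).
Proof. by move=> wW; apply: val_inj; rewrite -act_val// !val_opp actN act_val. Qed.

Lemma sigma_conj w a : w \in W -> (sigma a ^ w = sigma (w a))%g.
Proof.
move=> wW; apply/permP => b; rewrite conjgE !permM; apply: val_inj.
rewrite -[in LHS]act_val// !val_sigma actB actZ !act_val// -permM mulVg perm1.
by rewrite !ip_coroot -(ip_root _ _ wW) -(ip_root a a wW) -!permM mulVg perm1.
Qed.

(** Otherwise [a] would be a multiple of [b], which reducedness forbids. A simple reflection changes
    only one coordinate, so the one found here survives it and keeps the root positive. *)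
Lemma pos_coord a b : a \in pos -> b \in Pi -> a != b ->
  exists c, [/\ c \in Pi, c != b & 0 < ip (val a) (om c)].
Proof.
move=> ap bPi ab.
suff /exists_inP[c cPi /andP[]] : [exists c in Pi, (c != b) && (0 < ip (val a) (om c))].
  by exists c.
apply: contraT; rewrite negb_exists_in => /forall_inP h.
move: ap; rewrite posE => /coneP ap.
have e : val a = ip (val a) (om b) *: val b.
  rewrite {1}[val a]om_expand (bigD1 b)//= big1 ?addr0// => c /andP[cPi cb].
  have := h c cPi; rewrite cb /= -leNgt => h1.
  by rewrite (_ : ip (val a) (om c) = 0) ?scale0r//; apply/eqP; rewrite eq_le h1 ap.
have [] := roots_reduced (valP b) (c := ip (val a) (om b)).
- by rewrite -e; exact: valP.
- by move=> k1; case/eqP: ab; apply: val_inj; rewrite e k1 scale1r.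
- by move=> h3; have := ap b bPi; rewrite h3 ler0N1.
Qed.

Lemma sigma_pos a b : a \in Pi -> b \in pos -> b != a -> sigma a b \in pos.
Proof.
move=> aPi bp ba; have [c [cPi ca bc]] := pos_coord bp aPi ba.
apply: contraT; rewrite negE => /coneP/(_ c cPi).
rewrite ipNl val_sigma ipBl ipZl [ip (val a) _]om_val// (negbTE ca) mulr0 subr0.
by rewrite oppr_ge0 leNgt bc.
Qed.

Lemma simple_ip_le0 a b : a \in Pi -> b \in Pi -> a != b -> ip (val a) (val b) <= 0.
Proof.
move=> aPi bPi ab; have := sigma_pos bPi (simple_pos aPi) ab.
rewrite posE => /coneP/(_ b bPi).
rewrite val_sigma ipBl ipZl !om_val// eqxx mulr1 eq_sym (negbTE ab) sub0r oppr_ge0.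
by rewrite ip_coroot -mulrA mulrCA mulrA -mulrA pmulr_lle0 ?divr_gt0 ?root_gt0.
Qed.

(** * Words in the simple reflections *)

Definition word s : {perm T} := (\prod_(b <- s) sigma b)%g.

Lemma word_cons a s : word (a :: s) = (sigma a * word s)%g.
Proof. by rewrite /word big_cons. Qed.

Lemma word_cat s1 s2 : word (s1 ++ s2) = (word s1 * word s2)%g.
Proof. by rewrite /word big_cat. Qed.

Lemma wordW s : word s \in W.
Proof. by apply: group_prod => a _; exact: sigmaW. Qed.

(** The sign changes at some letter [b], and the only positive root that this reflection makes
    negative is [b] itself. *)
Lemma word_crossing s a : {subset s <= Pi} -> a \in pos -> word s a \notin pos ->
  exists s1 b s2, s = s1 ++ b :: s2 /\ word s1 a = b.
Proof.
elim: s a => [|b s IH] a sPi ap; first by rewrite /word big_nil perm1 ap.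
have [->|ab] := eqVneq a b.
  by move=> _; exists [::], b, s; rewrite /word big_nil perm1.
rewrite word_cons permM => /IH[||s1 [c [s2 [-> e]]]].
- by move=> c cs; rewrite sPi// inE cs orbT.
- by apply: sigma_pos => //; rewrite sPi ?mem_head.
by exists (b :: s1), c, s2; rewrite word_cons permM.
Qed.

(** The exchange condition. The prefix before the crossing letter conjugates [sigma a] to the
    reflection in that letter, so multiplying by [sigma a] deletes the letter. *)
Lemma word_exchange s a : {subset s <= Pi} -> a \in pos -> word s a \notin pos ->
  exists s', [/\ {subset s' <= Pi}, size s = (size s').+1 & word s' = (sigma a * word s)%g].
Proof.
move=> sPi ap sa; have [s1 [b [s2 [e e1]]]] := word_crossing sPi ap sa.
exists (s1 ++ s2); split.
- move=> c; rewrite mem_cat => h; apply: sPi; rewrite e mem_cat inE.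
  by case/orP: h => ->; rewrite ?orbT.
- by rewrite e !size_cat /= addnS.
rewrite e !word_cat word_cons -e1 -(sigma_conj _ (wordW _)) conjgE.
by rewrite !mulgA mulgK sigma2 mul1g.
Qed.

Lemma inversions_sigma w a : w \in W -> a \in Pi -> w a \in pos ->
  sigma a @: N w = N (sigma a * w)%g :\ a.
Proof.
move=> wW aPi wa; apply/setP => b; rewrite in_setD1.
have sa_a : sigma a a = opp a by [].
apply/imsetP/andP => [[c cN ->]|[ba bN]].
  move: cN; rewrite in_inversions => /andP[cp cn].
  have ca : c != a by apply: contraNneq cn => ->.
  split; last by rewrite in_inversions permM sigmaK cn sigma_pos.
  apply: contraTneq cp => e.
  by rewrite -[c](sigmaK a) e sa_a pos_opp negbK simple_pos.
move: bN; rewrite in_inversions permM => /andP[bp bn].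
exists (sigma a b); last by rewrite sigmaK.
by rewrite in_inversions sigma_pos.
Qed.

Lemma card_inversions_sigma w a : w \in W -> a \in Pi -> w a \in pos ->
  #|N (sigma a * w)%g| = #|N w|.+1.
Proof.
move=> wW aPi wa; rewrite (cardsD1 a) -inversions_sigma// card_imset; last exact: perm_inj.
rewrite in_inversions simple_pos// permM (_ : sigma a a = opp a)//.
by rewrite weyl_opp// pos_opp wa.
Qed.

(** * Heights and reduced words *)

Definition height v : R := \sum_(b in Pi) ip v (om b).

Lemma heightB u v : height (u - v) = height u - height v.
Proof. by rewrite -sumrB; apply: eq_bigr => b _; rewrite ipBl. Qed.

Lemma heightZ k v : height (k *: v) = k * height v.
Proof. by rewrite mulr_sumr; apply: eq_bigr => b _; rewrite ipZl. Qed.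

Lemma height_simple a : a \in Pi -> height (val a) = 1.
Proof.
move=> aPi; rewrite /height (bigD1 a)//= big1 => [|b /andP[bPi ba]].
  by rewrite om_val// eqxx addr0.
by rewrite om_val// (negbTE ba).
Qed.

Lemma height_gt0 a : a \in pos -> 0 < height (val a).
Proof.
rewrite posE => /coneP h; rewrite lt_def sumr_ge0 ?andbT//.
apply: contraNneq (root_neq0 a) => /eqP.
rewrite psumr_eq0// => /allP e; apply/eqP/om_inj => b bPi.
by apply/eqP; have := e b (mem_index_enum _); rewrite bPi.
Qed.

Lemma pos_ip_simple a : a \in pos -> exists2 b, b \in Pi & 0 < ip (val a) (val b).
Proof.
rewrite posE => /coneP h; apply/exists_inP; apply: contraT.
rewrite negb_exists_in => /forall_inP k.
have := root_gt0 a; rewrite ip_expand ltNge sumr_le0// => b bPi.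
by rewrite mulr_ge0_le0 ?h// leNgt ipC k.
Qed.

Lemma coroot_ip_gt0 v a : (0 < ip v (coroot ip (val a))) = (0 < ip v (val a)).
Proof. by rewrite ip_coroot -mulrA mulrCA pmulr_lgt0 ?divr_gt0 ?root_gt0. Qed.

Lemma coroot_ip_ge0 v a : (0 <= ip v (coroot ip (val a))) = (0 <= ip v (val a)).
Proof. by rewrite ip_coroot -mulrA mulrCA pmulr_lge0 ?divr_gt0 ?root_gt0. Qed.

Lemma height_sigma a b : a \in Pi ->
  height (val (sigma a b)) = height (val b) - ip (val b) (coroot ip (val a)).
Proof. by move=> aPi; rewrite val_sigma heightB heightZ (height_simple aPi) mulr1. Qed.

(** Take a positive root of least height among those reached from [a]: if it were not simple,
    reflecting in a simple root with which it has positive product would keep it positive and lower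
    its height. *)
Lemma root_simple_conj a : a \in pos ->
  exists s b, [/\ {subset s <= Pi}, b \in Pi & word s a = b].
Proof.
move=> ap.
pose P b := (b \in pos) && `[< exists2 s, {subset s <= Pi} & word s a = b >].
have Pa : P a by rewrite /P ap; apply/asboolP; exists [::]; rewrite // /word big_nil perm1.
case: (arg_minP (fun b => height (val b)) Pa) => b /andP[bp /asboolP[s sPi e]] bmin.
exists s, b; split => //; apply: contraT => bPi.
have [c cPi bc] := pos_ip_simple bp.
have : P (sigma c b).
  rewrite /P sigma_pos//=; last by apply: contraNneq bPi => ->.
  apply/asboolP; exists (rcons s c).
    by move=> d; rewrite mem_rcons inE => /orP[/eqP->//|]; exact: sPi.
  by rewrite -cats1 word_cat permM e /word big_seq1.
by move/bmin; rewrite height_sigma// lerBrDr gerDl leNgt coroot_ip_gt0 bc.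
Qed.

Lemma sigma_opp a : sigma (opp a) = sigma a.
Proof. by rewrite -[opp a]/(sigma a a) -(sigma_conj _ (sigmaW a)) conjgE sigmaV sigma2 mulg1. Qed.

Lemma weyl_word w : w \in W -> exists2 s, {subset s <= Pi} & w = word s.
Proof.
move: w; apply: weyl_ind => [|a|x y _ _ [s sPi ->] [t tPi ->]].
- by exists [::] => //; rewrite /word big_nil.
- wlog ap : a / a \in pos.
    have [ap|an] := boolP (a \in pos); first exact.
    by move=> /(_ (opp a)); rewrite pos_opp sigma_opp; apply.
  have [s [b [sPi bPi e]]] := root_simple_conj ap.
  have -> : sigma a = (word s * sigma b * (word s)^-1)%g.
    by rewrite -e -(sigma_conj _ (wordW s)) conjgE !mulgA mulgV mul1g mulgK.
  exists (s ++ b :: rev s).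
    move=> c; rewrite mem_cat inE mem_rev => /or3P[/sPi//|/eqP->//|/sPi//].
  rewrite word_cat word_cons mulgA; congr (_ * _)%g.
  elim: (s) => [|c t IH]; first by rewrite /word !big_nil invg1.
  by rewrite word_cons invMg IH rev_cons -cats1 word_cat /word big_seq1 sigmaV.
- exists (s ++ t); rewrite ?word_cat// => c.
  by rewrite mem_cat => /orP[/sPi|/tPi].
Qed.

(** Prepending a letter either adds one inversion, or removes one and, by exchange, shortens the
    word. *)
Lemma word_reduced w : w \in W -> exists s, [/\ {subset s <= Pi}, w = word s & size s = #|N w|].
Proof.
move=> /weyl_word[s sPi ->]; elim: s sPi => [|a s IH] sPi.
  exists [::]; split => //; apply/esym/eqP; rewrite cards_eq0; apply/eqP/setP => b.
  by rewrite in_inversions /word big_nil perm1 andbN inE.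
have aPi : a \in Pi by rewrite sPi ?mem_head.
have [b bs|t [tPi e sz]] := IH; first by rewrite sPi// inE bs orbT.
rewrite word_cons; have [wa|wa] := boolP (word s a \in pos).
  exists (a :: t); split; last by rewrite card_inversions_sigma ?wordW//= sz.
    by move=> b; rewrite inE => /orP[/eqP->//|/tPi].
  by rewrite word_cons e.
have := word_exchange tPi (simple_pos aPi); rewrite -e => /(_ wa)[t' [t'Pi sz' e']].
exists t'; split => //; apply: succn_inj; rewrite -sz' sz.
have := @card_inversions_sigma (sigma a * word s)%g a; rewrite mulgA sigma2 mul1g; apply => //.
  by rewrite groupM ?sigmaW ?wordW.
by rewrite permM (_ : sigma a a = opp a)// weyl_opp ?wordW// pos_opp.
Qed.

Lemma inversions_eq0 w : w \in W -> N w = set0 -> w = 1%g.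
Proof.
move=> /word_reduced[s [_ -> /[swap] ->]]; rewrite cards0 => /size0nil->.
by rewrite /word big_nil.
Qed.

(** Equal inversion sets mean equal signs on all roots, so [x^-1 * y] has no inversion. *)
Lemma inversions_inj : {in W &, injective N}.
Proof.
move=> x y xW yW e; apply/eqP; rewrite eq_mulVg1; apply/eqP/inversions_eq0.
  by rewrite groupM ?groupV.
apply/setP => a; rewrite in_set0 in_inversions permM; apply/negP => /andP[ap].
have [xa|xa] := boolP (x^-1%g a \in pos).
  have : x^-1%g a \notin N x by rewrite in_inversions permKV ap andbF.
  by rewrite e in_inversions xa /= negbK => ->.
have : opp (x^-1%g a) \in N x by rewrite in_inversions pos_opp xa weyl_opp// permKV pos_opp ap.
by rewrite e in_inversions pos_opp xa weyl_opp// pos_opp /= negbK => ->.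
Qed.

Lemma act_cone w v : w \in W -> {in Pi, forall b, w b \in pos} -> cone v -> cone (act w v).
Proof.
move=> wW h /coneP hv; apply: cone_sum => b bPi; apply: coneZ; first exact: hv.
by rewrite -posE h.
Qed.

Lemma weyl_neq1_simple w : w \in W -> w != 1%g -> exists2 b, b \in Pi & w b \notin pos.
Proof.
move=> wW; apply: contra_neqP => h; apply: inversions_eq0 => //; apply/setP => a.
rewrite in_set0 in_inversions; apply/negP => /andP[ap]; rewrite posE -act_val// act_cone//.
  by move=> b bPi; apply: contraT => wb; case: h; exists b.
by rewrite -posE.
Qed.

(** * Dominance *)

Definition dominant v : bool := [forall b in Pi, 0 <= ip v (val b)].

Lemma dominantP v : reflect {in Pi, forall b, 0 <= ip v (val b)} (dominant v).
Proof. exact: forall_inP. Qed.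

Lemma dominant_ip u v : dominant u -> cone v -> 0 <= ip v u.
Proof.
move=> /dominantP hu /coneP hv; rewrite ip_expand sumr_ge0// => b bPi.
by rewrite mulr_ge0 ?hv// ipC hu.
Qed.

Lemma dominant_om a : a \in Pi -> dominant (om a).
Proof. by move=> aPi; apply/dominantP => b bPi; rewrite ipC om_val ?ler0n. Qed.

(** Induction on the inversions: with w = sigma b * w', the difference is v - w'v plus a nonnegative
    multiple of the positive root w'(b). *)
Lemma dominant_sub_act w v : w \in W -> dominant v -> cone (v - act w v).
Proof.
have [n] := ubnP #|N w|; elim: n w => // n IH w Nw wW vdom.
have [->|w1] := eqVneq w 1%g; first by rewrite act1 subrr cone0.
have [b bPi wb] := weyl_neq1_simple wW w1.
pose w' := (sigma b * w)%g; have w'W : w' \in W by rewrite groupM ?sigmaW.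
have w'b : w' b \in pos by rewrite permM (_ : sigma b b = opp b)// weyl_opp// pos_opp.
have e : w = (sigma b * w')%g by rewrite mulgA sigma2 mul1g.
have Nw' : (#|N w'| < n)%N by rewrite -ltnS -(card_inversions_sigma w'W bPi)// -e.
rewrite e actM// act_sigma actB actZ opprB addrCA; apply: coneD; last exact: IH.
rewrite act_val//; apply: coneZ; last by rewrite -posE.
by rewrite ip_coroot divr_ge0 ?ip_ge0// mulr_ge0 ?(dominantP _ vdom).
Qed.

Lemma dominant_orbit w v : w \in W -> dominant v -> dominant (act w v) -> act w v = v.
Proof.
move=> wW vd wvd; apply/esym/subr0_eq/cone_anti; first exact: dominant_sub_act.
have := dominant_sub_act (groupVr wW) wvd.
by rewrite actK// opprB.
Qed.

(** * Biclosed sets of positive roots *)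

(** If one of the two Cartan integers is 1, a reflection gives the difference up to sign. If both
    are at least 2, then (a,b) bounds (a,a) and (b,b), and a - b has norm zero. *)
Lemma root_sub a b : 0 < ip (val a) (val b) -> a != b ->
  exists c, val c = val a - val b.
Proof.
move=> ab0 ab.
have int1 (c d : T) : 0 < ip (val c) (val d) -> ip (val c) (coroot ip (val d)) != 1 ->
    ip (val d) (val d) <= ip (val c) (val d).
  move=> cd0 cd1; have /intrP[m em] := roots_crystallographic (valP d) (valP c).
  have m0 : 0 < m by rewrite -(ltr0z R) -em coroot_ip_gt0.
  have m1 : m != 1 by apply: contraNneq cd1 => m1; rewrite em m1.
  have m2 : (2 <= m)%R by move: m m0 m1 {em} => [[|[|m]]|m].
  have : 2 <= ip (val c) (coroot ip (val d)) by rewrite em (ler_int R 2).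
  by rewrite ip_coroot ler_pdivlMr ?root_gt0// ler_pM2l.
have [e|n1] := eqVneq (ip (val a) (coroot ip (val b))) 1.
  by exists (sigma b a); rewrite val_sigma e scale1r.
have [e|m1] := eqVneq (ip (val b) (coroot ip (val a))) 1.
  by exists (opp (sigma a b)); rewrite val_opp val_sigma e scale1r opprB.
have h1 := int1 _ _ ab0 n1; have ba0 := ab0; rewrite ipC in ba0.
have h2 := int1 _ _ ba0 m1; rewrite ipC in h2.
case/eqP: ab; apply: val_inj; apply/eqP; rewrite -subr_eq0; apply/eqP/ip_eq0.
apply/eqP; rewrite eq_le ip_ge0 andbT !ipBl !ipBr [ip (val b) (val a)]ipC; lra.
Qed.

Lemma pos_nonsimple a : a \in pos -> a \notin Pi ->
  exists b c, [/\ b \in Pi, c \in pos & val a = val b + val c].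
Proof.
move=> ap aPi; have [b bPi ab] := pos_ip_simple ap.
have ba : a != b by apply: contraNneq aPi => ->.
have [c e] := root_sub ab ba; exists b, c; split => //; last by rewrite e addrC subrK.
apply: contraT; rewrite negE => cn.
have [d [dPi db ad]] := pos_coord ap bPi ba.
have := coneP _ cn d dPi; rewrite ipNl e ipBl [ip (val b) _]om_val// (negbTE db).
by rewrite subr0 oppr_ge0 leNgt ad.
Qed.

Definition sum_closed (S : {set T}) := forall a b c,
  a \in S -> b \in S -> c \in pos -> val c = val a + val b -> c \in S.

(** An element of [S] of least height is simple: otherwise it is a sum of two lower positive roots,
    both outside [S], against closure of the complement. *)
Lemma biclosed_simple (S : {set T}) : S \subset pos -> sum_closed (pos :\: S) ->
  S != set0 -> exists2 a, a \in Pi & a \in S.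
Proof.
move=> Sp cl /set0Pn[a0 a0S].
case: (arg_minP (fun b => height (val b)) a0S) => a aS' amin; have {aS'}aS : a \in S by [].
have ap := subsetP Sp a aS.
exists a => //; apply: contraT => aPi.
have [b [c [bPi cp e]]] := pos_nonsimple ap aPi.
have lt d f : d \in pos -> val a = val d + val f -> f \notin S.
  move=> /height_gt0 d0 e'; apply/negP => /amin.
  have -> : val f = val a - val d by rewrite e' addrC addKr.
  by rewrite heightB lerBrDr gerDl leNgt d0.
have bS : b \notin S by apply: (lt c) => //; rewrite addrC.
have cS : c \notin S by apply: (lt b) => //; exact: simple_pos.
have := cl b c a; rewrite !in_setD bS cS cp ap simple_pos//= aS.
by move/(_ isT isT isT e).
Qed.

Lemma simple_sum a b c : a \in Pi -> b \in pos -> c \in pos ->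
  val a != val b + val c.
Proof.
move=> aPi bp cp; apply/eqP => e.
have [ba|ba] := eqVneq b a.
  by move: (root_neq0 c); rewrite -(addKr (val b) (val c)) -e ba addNr eqxx.
have [d [dPi da bd]] := pos_coord bp aPi ba.
have := congr1 (fun v => ip v (om d)) e; rewrite /= ipDl om_val// (negbTE da) mulr0n.
by move: cp; rewrite posE => /coneP/(_ d dPi) cd; lra.
Qed.

(* Induction on [#|S|]: peel off a simple root [a] in [S] and reflect the rest. *)
Lemma biclosed_inversions (S : {set T}) : S \subset pos -> sum_closed S -> sum_closed (pos :\: S) ->
  exists2 w, w \in W & N w = S.
Proof.
have [n] := ubnP #|S|; elim: n S => // n IH S Sn Sp cS cS'.
have [->|S0] := eqVneq S set0.
  exists 1%g; rewrite ?group1//; apply/setP => a.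
  by rewrite in_inversions perm1 andbN in_set0.
have [a aPi aS] := biclosed_simple Sp cS' S0.
have ap := simple_pos aPi.
pose S' := sigma a @: (S :\ a).
have inS' b : (b \in S') = (sigma a b \in S) && (sigma a b != a).
  rewrite -[b in LHS](sigmaK a) mem_imset ?in_setD1 1?andbC//; exact: perm_inj.
have sum b c d : val d = val b + val c ->
    val (sigma a d) = val (sigma a b) + val (sigma a c).
  by move=> e; rewrite -!act_val ?sigmaW// e actD.
have sa : sigma a a = opp a by [].
have oppS b : b \in S -> opp b \notin S.
  by move=> /(subsetP Sp) bp; apply/negP => /(subsetP Sp); rewrite pos_opp bp.
have S'p b : b \in S' -> b \in pos /\ b != a.
  rewrite inS' => /andP[h1 h2]; split.
    by rewrite -[b](sigmaK a) sigma_pos// (subsetP Sp).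
  by apply: contraTneq h1 => ->; rewrite sa; exact: oppS.
have S'sub : S' \subset pos by apply/subsetP => b /S'p[].
have card : (#|S'| < n)%N.
  rewrite card_imset; last exact: perm_inj.
  by move: Sn; rewrite (cardsD1 a) aS.
have [||w wW e] := IH _ card S'sub.
- move=> b c d bS' cS2 dp e.
  have [bp _] := S'p _ bS'; have [cp _] := S'p _ cS2.
  have da : d != a by apply/eqP => da; have := simple_sum aPi bp cp; rewrite -e da eqxx.
  move: bS' cS2; rewrite !inS' => /andP[b1 b2] /andP[c1 c2].
  rewrite (cS _ _ _ b1 c1 _ (sum _ _ _ e))/=; last by rewrite sigma_pos.
  apply/eqP => ea; have := simple_sum aPi (subsetP Sp _ b1) (subsetP Sp _ c1).
  by rewrite -(sum _ _ _ e) ea eqxx.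
- have key b c d : b \in pos -> c \in pos -> b \notin S' -> c \notin S' ->
      d \in pos -> val d = val b + val c -> b != a -> d \notin S'.
    move=> bp cp bS cS2 dp e ba; apply/negP => dS'.
    have [_ da] := S'p _ dS'.
    have sb : sigma a b \in pos by rewrite sigma_pos.
    have sba : sigma a b != a.
      by apply: contraTneq bp => h; rewrite -[b](sigmaK a) h sa pos_opp ap.
    have nsb : sigma a b \notin S by move: bS; rewrite inS' sba andbT.
    have e' := sum _ _ _ e; move: dS'; rewrite inS' => /andP[d1 d2].
    (* For c = a the relation reads sigma a b = sigma a d + a, a sum of two elements of [S].
       Otherwise all three reflected roots stay positive and co-closure of [S] applies. *)
    have [ca|ca] := eqVneq c a.
      case/negP: nsb; apply: (cS (sigma a d) a) => //.
      by rewrite e' ca sa val_opp subrK.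
    have sc : sigma a c \in pos by rewrite sigma_pos.
    have sca : sigma a c != a.
      by apply: contraTneq cp => h; rewrite -[c](sigmaK a) h sa pos_opp ap.
    have nsc : sigma a c \notin S by move: cS2; rewrite inS' sca andbT.
    have sd : sigma a d \in pos by rewrite sigma_pos.
    have := cS' (sigma a b) (sigma a c) (sigma a d).
    by rewrite !in_setD nsb nsc sb sc sd d1 /= => /(_ isT isT isT e').
  move=> b c d; rewrite !in_setD => /andP[bS bp] /andP[cS2 cp] dp e; rewrite dp andbT.
  have [ba|ba] := eqVneq b a; last exact: (key b c).
  have [ca|ca] := eqVneq c a; last by apply: (key c b) => //; rewrite addrC.
  (* Here b = c = a, and 2a would be a root. *)
  have [] := roots_reduced (valP a) (c := 2); last 2 first.
  - lra.
  - lra.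
  by rewrite scaler_nat mulr2n -{1}ba -ca -e; exact: valP.
exists (sigma a * w)%g; first by rewrite groupM ?sigmaW.
have aw : w a \in pos.
  have : a \notin N w by rewrite e; apply/negP => /S'p[_]; rewrite eqxx.
  by rewrite in_inversions ap /= negbK.
apply/setP => b; have [->|ba] := eqVneq b a.
  by rewrite aS in_inversions ap permM sa weyl_opp// pos_opp negbK aw.
have : b \in sigma a @: N w = (b \in S).
  rewrite e -[b in LHS](sigmaK a) mem_imset; last exact: perm_inj.
  by rewrite inS' sigmaK ba andbT.
by rewrite inversions_sigma// in_setD1 ba.
Qed.

(** * The highest root *)

Lemma dominant_conj a : exists2 w, w \in W & dominant (val (w a)).
Proof.
pose P b := `[< exists2 w, w \in W & w a = b >].
have Pa : P a by apply/asboolP; exists 1%g; rewrite ?group1// perm1.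
case: (arg_maxP (fun b => height (val b)) Pa) => b /asboolP[w wW e] bmax.
exists w => //; rewrite e; apply/dominantP => c cPi; rewrite leNgt; apply/negP => bc.
have /bmax : P (sigma c b).
  by apply/asboolP; exists (w * sigma c)%g; rewrite ?groupM ?sigmaW// permM e.
by rewrite height_sigma//= gerBl coroot_ip_ge0 leNgt bc.
Qed.

Context {theta : T}.
Hypothesis theta_high : is_highest_root Pi theta.

Local Notation Theta := (val theta).
Local Notation level a := (ip (val a) (coroot ip Theta)).
Local Notation Delta0 := (Delta theta 0).
Local Notation Delta1 := (Delta theta 1).

Lemma theta_sub a : cone (Theta - val a).
Proof. exact/(nat_comb_cone (subxx _))/theta_high. Qed.

Lemma theta_dominant : dominant Theta.
Proof.
apply/dominantP => b bPi; have := theta_sub (sigma b theta).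
rewrite val_sigma subKr => /coneP/(_ b bPi); rewrite ipZl om_val// eqxx mulr1.
by rewrite coroot_ip_ge0.
Qed.

Lemma theta_pos : theta \in pos.
Proof.
apply: contraT; rewrite negE => h.
have := coneD (theta_sub (opp theta)) h; rewrite val_opp opprK addrK => h2.
by have := root_neq0 theta; rewrite (cone_anti h2 h) eqxx.
Qed.

Lemma theta_sub_ip_ge0 a u : dominant u -> 0 <= ip (Theta - val a) u.
Proof. by move=> ud; exact: dominant_ip (theta_sub a). Qed.

(** For a dominant conjugate b of [a], theta - b lies in the cone; pairing it with b and with theta
    gives (b,b) <= (theta,b) <= (theta,theta). In [long_conj], equality throughout forces b =
    theta. *)
Lemma theta_longest a : ip (val a) (val a) <= ip Theta Theta.
Proof.
have [w wW wd] := dominant_conj a; rewrite -(ip_root a a wW).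
have := theta_sub_ip_ge0 (w a) theta_dominant; have := theta_sub_ip_ge0 (w a) wd.
by rewrite !ipBl [ip Theta (val (w a))]ipC; lra.
Qed.

Lemma long_conj a : ip (val a) (val a) = ip Theta Theta ->
  exists2 w, w \in W & w theta = a.
Proof.
move=> al; have [w wW wd] := dominant_conj a.
have e : val (w a) = Theta.
  apply/esym/subr0_eq/ip_eq0.
  have := theta_sub_ip_ge0 (w a) theta_dominant; have := theta_sub_ip_ge0 (w a) wd.
  have := ip_root a a wW; rewrite !ipBl !ipBr [ip Theta (val (w a))]ipC al; lra.
by exists w^-1%g; rewrite ?groupV// -(val_inj e) permK.
Qed.

Lemma in_Delta (j : int) a : (a \in Delta theta j) = (level a == j%:~R).
Proof. by rewrite inE. Qed.

Lemma level_theta : level theta = 2.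
Proof. by rewrite ip_coroot mulfK// gt_eqF ?root_gt0. Qed.

Lemma level_opp a : level (opp a) = - level a.
Proof. by rewrite val_opp ipNl. Qed.

Lemma level_ge2 a : 2 <= level a -> a = theta.
Proof.
rewrite ip_coroot ler_pdivlMr ?root_gt0// ler_pM2l// => h.
apply: val_inj; apply/subr0_eq/ip_eq0; have := theta_longest a.
have := ip_ge0 (val a - Theta); rewrite !ipBl !ipBr [ip Theta (val a)]ipC; lra.
Qed.

Lemma level_int a : level a \is a Num.int.
Proof. exact: roots_crystallographic (valP theta) (valP a). Qed.

Lemma level_pos a : a \in pos -> 0 <= level a.
Proof.
rewrite posE => ac; rewrite ip_coroot divr_ge0 ?ip_ge0// mulr_ge0//.
exact: dominant_ip theta_dominant ac.
Qed.

Lemma pos_cases a : a \in pos ->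
  [\/ a \in Delta0_pos Pi theta, a \in Delta1 | a = theta].
Proof.
move=> ap; have := level_pos ap; have /intrP[m em] := level_int a.
have := @level_ge2 a; rewrite em ler0z (ler_int R 2).
case: m em => [[|[|m]]|//] em h _.
- by constructor 1; rewrite inE ap in_Delta em eqxx.
- by constructor 2; rewrite in_Delta em eqxx.
- by constructor 3; exact: h.
Qed.

Lemma Delta1_level a : a \in Delta1 -> level a = 1.
Proof. by rewrite in_Delta => /eqP->. Qed.

Lemma Delta0_level a : a \in Delta0 -> level a = 0.
Proof. by rewrite in_Delta => /eqP->. Qed.

Lemma Delta1_pos a : a \in Delta1 -> a \in pos.
Proof.
move=> /Delta1_level a1; apply: contraT; rewrite -pos_opp => /level_pos.
by rewrite level_opp a1 ler0N1.
Qed.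

Lemma theta_notin_Delta1 : theta \notin Delta1.
Proof. by rewrite in_Delta level_theta (eqr_nat R 2 1). Qed.

Lemma Delta1_neq_theta a : a \in Delta1 -> a != theta.
Proof. by apply: contraTneq => ->; exact: theta_notin_Delta1. Qed.

(** On level one this is theta - a; the reflection makes it a total involution of the roots. *)
Definition compl a : T := opp (sigma theta a).

Lemma complK : involutive compl.
Proof. by move=> a; rewrite /compl weyl_opp ?sigmaW// sigmaK oppK. Qed.

Lemma val_compl a : a \in Delta1 -> val (compl a) = Theta - val a.
Proof. by move=> /Delta1_level a1; rewrite val_opp val_sigma a1 scale1r opprB. Qed.

Lemma compl_Delta1 a : (compl a \in Delta1) = (a \in Delta1).
Proof.
suff h b : b \in Delta1 -> compl b \in Delta1.
  by apply/idP/idP => /h; rewrite ?complK.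
move=> b1; rewrite in_Delta val_compl// ipBl level_theta Delta1_level//.
by apply/eqP; lra.
Qed.

Lemma compl_eq a b : a \in Delta1 -> val a + val b = Theta -> b = compl a.
Proof. by move=> a1 e; apply: val_inj; rewrite val_compl// -e addrC addKr. Qed.

Lemma level_sum a b c : val c = val a + val b -> level c = level a + level b.
Proof. by move=> ->; rewrite ipDl. Qed.

Lemma Delta1_sum a b c : a \in Delta1 -> b \in Delta1 -> val c = val a + val b ->
  c = theta.
Proof.
move=> a1 b1 /level_sum e; apply: level_ge2.
by rewrite e !Delta1_level//; lra.
Qed.

(** Simple roots have nonnegative level, so level zero kills every coefficient outside [Pi0]. *)
Lemma Delta0_nat_comb a : a \in Delta0_pos Pi theta -> nat_comb (Pi0 Pi theta) (val a).
Proof.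
rewrite inE => /andP[a0 ap]; have : a \in pos by [].
rewrite inE => /asboolP[k e].
have l0 c : c \in Pi -> 0 <= level c *+ k c.
  by move=> cPi; rewrite mulrn_wge0// level_pos// simple_pos.
have := Delta0_level a0; rewrite e ip_suml.
rewrite (eq_bigr (fun c => level c *+ k c)) => [/eqP|c _]; last by rewrite linearMnl.
rewrite psumr_eq0// => /allP h.
exists k; rewrite [LHS](bigID (mem Delta0))/= [X in _ + X]big1 ?addr0.
  by apply: eq_bigl => b; rewrite in_setI.
move=> b /andP[bPi]; rewrite in_Delta => b0.
have := h b (mem_index_enum _); rewrite bPi /= mulrn_eq0 (negbTE b0) orbF => /eqP->.
exact: mulr0n.
Qed.

(** * Upper ideals of roots of level one *)

Lemma Pi0_sub : Pi0 Pi theta \subset Pi.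
Proof. exact: subsetIl. Qed.

Lemma prec_refl a : prec Pi theta a a.
Proof.
apply/asboolP; exists (fun=> 0%N); rewrite subrr big1// => b _; exact: mulr0n.
Qed.

Lemma prec_trans b a c : prec Pi theta a b -> prec Pi theta b c -> prec Pi theta a c.
Proof.
move=> /asboolP[k e] /asboolP[l f]; apply/asboolP; exists (fun d => l d + k d)%N.
rewrite -(subrKA (val b)) f e -big_split; apply: eq_bigr => d _.
by rewrite mulrnDr.
Qed.

Lemma prec_cone a b : prec Pi theta a b -> cone (val b - val a).
Proof. by move=> /asboolP; apply: nat_comb_cone; exact: Pi0_sub. Qed.

Lemma prec_anti a b : prec Pi theta a b -> prec Pi theta b a -> a = b.
Proof.
move=> /prec_cone h1 /prec_cone h2; apply: val_inj; apply/esym/subr0_eq.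
by apply: cone_anti => //; rewrite opprB.
Qed.

Lemma prec_add a b c : a \in Delta0_pos Pi theta -> val c = val a + val b ->
  prec Pi theta b c.
Proof. by move=> /Delta0_nat_comb a0 e; apply/asboolP; rewrite e addrK. Qed.

Lemma cone_height_le0 v : cone v -> height v <= 0 -> v = 0.
Proof.
move=> /coneP h h0; apply: om_inj => b bPi.
have /eqP : height v == 0 by rewrite eq_le h0 sumr_ge0.
by move/eqP; rewrite psumr_eq0// => /allP/(_ b (mem_index_enum _)); rewrite bPi => /eqP.
Qed.

Lemma min_elts_below (S : {set T}) a : a \in S ->
  exists2 b, b \in min_elts Pi theta S & prec Pi theta b a.
Proof.
move=> aS; pose P b := (b \in S) && prec Pi theta b a.
have Pa : P a by rewrite /P aS prec_refl.
case: (arg_minP (fun b => height (val b)) Pa) => b /andP[bS ba] bmin.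
exists b => //; rewrite inE bS; apply/forall_inP => c cS; apply/implyP => cb.
have /bmin/= : P c by rewrite /P cS (prec_trans cb ba).
rewrite -subr_le0 -heightB => /(cone_height_le0 (prec_cone cb))/subr0_eq e.
by apply/eqP/val_inj; rewrite e.
Qed.

Lemma min_elts_antichain (S : {set T}) : S \subset Delta1 ->
  min_elts Pi theta S \in antichains Pi theta.
Proof.
move=> S1; rewrite inE; apply/andP; split.
  by apply/subsetP => a; rewrite inE => /andP[/(subsetP S1)].
apply/forall_inP => a; rewrite inE => /andP[aS _].
apply/forall_inP => b; rewrite inE => /andP[_ /forall_inP/(_ a aS)].
by [].
Qed.

Lemma upper_ideal_min (S : {set T}) : S \subset Delta1 ->
  (forall a b, a \in S -> b \in Delta1 -> prec Pi theta a b -> b \in S) ->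
  upper_ideal Pi theta (min_elts Pi theta S) = S.
Proof.
move=> S1 Sup; apply/setP => a; rewrite inE; apply/andP/idP.
  move=> [a1 /exists_inP[b]]; rewrite inE => /andP[bS _]; exact: Sup.
move=> aS; split; first exact: (subsetP S1).
have [b bS ba] := min_elts_below aS.
by apply/exists_inP; exists b.
Qed.

Lemma min_upper_ideal G : G \in antichains Pi theta ->
  min_elts Pi theta (upper_ideal Pi theta G) = G.
Proof.
rewrite inE => /andP[G1 /forall_inP anti].
have sub a : a \in G -> a \in upper_ideal Pi theta G.
  move=> aG; rewrite inE (subsetP G1 _ aG); apply/exists_inP.
  by exists a => //; exact: prec_refl.
apply/setP => a; rewrite inE; apply/andP/idP => [[]|aG].
  rewrite inE => /andP[_ /exists_inP[b bG ba]] /forall_inP/(_ b (sub _ bG)).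
  by rewrite ba => /eqP <-.
split; first exact: sub.
apply/forall_inP => b; rewrite inE => /andP[_ /exists_inP[c cG cb]].
apply/implyP => ba; apply/eqP; apply: (prec_anti ba).
have := anti c cG => /forall_inP/(_ a aG); rewrite (prec_trans cb ba) => /eqP <-.
exact: cb.
Qed.

Lemma upper_ideal_up G a b : a \in upper_ideal Pi theta G -> b \in Delta1 ->
  prec Pi theta a b -> b \in upper_ideal Pi theta G.
Proof.
rewrite !inE => /andP[_ /exists_inP[c cG ca]] -> ab /=; apply/exists_inP.
by exists c => //; exact: (prec_trans ca ab).
Qed.

Lemma in_ideal w a : (a \in Delta1 :\: N w) = (a \in Delta1) && (w a \in pos).
Proof.
rewrite in_setD in_inversions andbC; have [a1|//] := boolP (a \in Delta1).
by rewrite Delta1_pos//= negbK.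
Qed.

Lemma W0P w : reflect (w \in W /\ {in Delta0_pos Pi theta, forall a, w a \in pos})
  (w \in W0 Pi theta).
Proof.
rewrite inE; apply: (iffP andP) => -[wW h]; split => //; first exact/forall_inP.
exact/forall_inP.
Qed.

Lemma W0_W w : w \in W0 Pi theta -> w \in W.
Proof. by case/W0P. Qed.

(** [w] sends [Pi0], hence b - a, into the cone. This makes the level-one roots kept positive by [w]
    an upper ideal. *)
Lemma prec_act w a b : w \in W0 Pi theta -> prec Pi theta a b -> w a \in pos -> w b \in pos.
Proof.
move=> /W0P[wW h] /asboolP[k e]; rewrite !posE => wa.
have -> : val (w b) = val (w a) + act w (val b - val a).
  by rewrite actB !act_val// addrC subrK.
apply: (coneD wa); rewrite e act_sum; apply: cone_sum => c.
rewrite inE => /andP[cPi c0]; rewrite -scaler_nat actZ; apply: coneZ => //.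
by rewrite act_val// -posE h// inE c0 simple_pos.
Qed.

Lemma upper_ideal_tau w : w \in W0 Pi theta ->
  upper_ideal Pi theta (tau Pi theta w) = Delta1 :\: N w.
Proof.
move=> w0; apply: upper_ideal_min; first exact: subsetDl.
move=> a b; rewrite !in_ideal => /andP[_ wa] -> ab /=.
exact: (prec_act w0 ab wa).
Qed.

Lemma act_theta w a : w \in W -> a \in Delta1 ->
  val (w theta) = val (w a) + val (w (compl a)).
Proof.
move=> wW a1; rewrite -(act_val theta) -?(act_val a) -?(act_val (compl a))//.
by rewrite -actD val_compl// addrC subrK.
Qed.

Lemma sum_pos a b c : val c = val a + val b -> a \in pos -> b \in pos -> c \in pos.
Proof. by rewrite !posE => ->; exact: coneD. Qed.

Lemma sum_neg a b c : val c = val a + val b -> a \notin pos -> b \notin pos -> c \notin pos.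
Proof. by rewrite !negE => ->; rewrite opprD; exact: coneD. Qed.

(** * The fibers of tau *)

Lemma W0_inj w w' : w \in W0 Pi theta -> w' \in W0 Pi theta ->
  Delta1 :\: N w = Delta1 :\: N w' -> (w theta \in pos) = (w' theta \in pos) -> w = w'.
Proof.
move=> /W0P[wW h] /W0P[w'W h'] e et; apply: inversions_inj => //; apply/setP => a.
rewrite !in_inversions; have [ap|//] := boolP (a \in pos).
have [a0|a1|->] := pos_cases ap; first by rewrite h// h'.
  by have := in_ideal w a; rewrite e in_ideal a1 /= => ->.
by rewrite et.
Qed.

Lemma sigma_theta_Delta0 a : a \in Delta0_pos Pi theta -> sigma theta a = a.
Proof.
rewrite inE => /andP[/Delta0_level a0 _]; apply: val_inj.
by rewrite val_sigma a0 scale0r subr0.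
Qed.

Lemma W0_sigma_theta w : w \in W0 Pi theta -> (sigma theta * w)%g \in W0 Pi theta.
Proof.
move=> /W0P[wW h]; apply/W0P; split; first by rewrite groupM ?sigmaW.
by move=> a a0; rewrite permM sigma_theta_Delta0// h.
Qed.

Lemma sigma_theta_act w : w \in W -> (sigma theta * w)%g theta = opp (w theta).
Proof. by move=> wW; rewrite permM -weyl_opp. Qed.

(** Without a pair summing to theta, [compl] maps [S] into its complement in [Delta1]; having half
    the size of [Delta1] makes this map onto. *)
Lemma lagrangianP (S : {set T}) : S \subset Delta1 ->
  reflect {in Delta1, forall a, (compl a \in S) = (a \notin S)} (lagrangian theta S).
Proof.
move=> S1; have ci : injective compl by exact: inv_inj complK.
have cS a : (a \in compl @: S) = (compl a \in S) by rewrite -{1}[a]complK mem_imset.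
have cD : #|Delta1 :\: S| = (#|Delta1| - #|S|)%N.
  by rewrite cardsD (setIidPr S1).
have le := subset_leq_card S1.
apply: (iffP and3P) => [[_ /eqP half] /exists_inPn noP a a1|h].
  have sub : compl @: S \subset Delta1 :\: S.
    apply/subsetP => b; rewrite cS in_setD => cb.
    have cb1 := subsetP S1 _ cb; rewrite compl_Delta1 in cb1; rewrite cb1 andbT.
    apply/negP => bS; have := noP b bS => /exists_inPn/(_ _ cb).
    by rewrite val_compl// addrC subrK eqxx.
  have /eqP e : compl @: S == Delta1 :\: S.
    by rewrite eqEcard sub cD card_imset// -half -addnn addnK leqnn.
  by rewrite -cS e in_setD a1 andbT.
split => //.
  have e : compl @: S = Delta1 :\: S.
    apply/setP => a; rewrite cS in_setD; have [a1|a1] := boolP (a \in Delta1).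
      by rewrite h// andbT.
    by rewrite andbF; apply: contraNF a1 => /(subsetP S1); rewrite compl_Delta1.
  have := cD; rewrite -e card_imset// => f.
  by rewrite -addnn {1}f subnK.
apply/exists_inPn => a aS; apply/exists_inPn => b bS.
apply: contraL bS => /eqP/(compl_eq (subsetP S1 _ aS)) ->.
by rewrite h ?aS// (subsetP S1).
Qed.

Lemma ideal_sub w : Delta1 :\: N w \subset Delta1.
Proof. exact: subsetDl. Qed.

Lemma lagrangian_idealP w :
  reflect {in Delta1, forall a, (w (compl a) \in pos) = (w a \notin pos)}
    (lagrangian theta (Delta1 :\: N w)).
Proof.
apply: (iffP (lagrangianP (ideal_sub w))) => h a a1.
  by have := h a a1; rewrite !in_ideal compl_Delta1 a1.
by rewrite !in_ideal compl_Delta1 a1 h.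
Qed.

Lemma not_lagrangian_sign w w' : w \in W -> w' \in W ->
  Delta1 :\: N w = Delta1 :\: N w' -> ~~ lagrangian theta (Delta1 :\: N w) ->
  (w theta \in pos) = (w' theta \in pos).
Proof.
move=> wW w'W e nl.
have /existsP[a /andP[a1 /eqP ca]] :
    [exists a, (a \in Delta1) && ((w (compl a) \in pos) == (w a \in pos))].
  apply: contraNT nl => /existsPn h; apply/lagrangian_idealP => a a1.
  by have := h a; rewrite a1 /=; do 2!case: (_ \in _).
have ew b : b \in Delta1 -> (w b \in pos) = (w' b \in pos).
  by move=> b1; have := in_ideal w b; rewrite e in_ideal b1.
have t := act_theta wW a1; have t' := act_theta w'W a1.
have [wa|wa] := boolP (w a \in pos).
  rewrite (sum_pos t) ?ca// (sum_pos t')// -ew// ?compl_Delta1// ca//.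
rewrite (negbTE (sum_neg t _ _)) ?ca//; apply/esym/negbTE.
by rewrite (sum_neg t')// -ew// ?compl_Delta1// ca.
Qed.

Lemma sigma_theta_ideal w : w \in W -> lagrangian theta (Delta1 :\: N w) ->
  Delta1 :\: N (sigma theta * w)%g = Delta1 :\: N w.
Proof.
move=> wW /lagrangian_idealP h; apply/setP => a; rewrite !in_ideal permM.
have [a1|//] := boolP (a \in Delta1).
by rewrite -[sigma theta a]oppK weyl_opp// pos_opp -/(compl a) h// negbK.
Qed.

Lemma in_fiber w x : w \in W0 Pi theta ->
  (x \in tau_fiber Pi theta (tau Pi theta w)) =
  (x \in W0 Pi theta) && (Delta1 :\: N x == Delta1 :\: N w).
Proof.
move=> w0; rewrite inE; have [x0|//] := boolP (x \in W0 Pi theta).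
rewrite /=; apply/eqP/eqP => [e|e]; last by rewrite /tau e.
by rewrite -!upper_ideal_tau// e.
Qed.

Lemma fiber_not_lagrangian w : w \in W0 Pi theta ->
  ~~ lagrangian theta (Delta1 :\: N w) -> tau_fiber Pi theta (tau Pi theta w) = [set w].
Proof.
move=> w0 nl; apply/setP => x; rewrite in_fiber// in_set1; apply/andP/eqP => [|->//].
move=> [x0 /eqP e]; apply: W0_inj => //.
by apply: not_lagrangian_sign; rewrite ?e// W0_W.
Qed.

Lemma fiber_lagrangian w : w \in W0 Pi theta ->
  lagrangian theta (Delta1 :\: N w) ->
  tau_fiber Pi theta (tau Pi theta w) = [set w; (sigma theta * w)%g].
Proof.
move=> w0 l; have wW := W0_W w0; apply/setP => x; rewrite in_fiber// in_set2.
apply/andP/orP => [[x0 /eqP e]|[/eqP->|/eqP->]]; last 2 first.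
- by [].
- by rewrite sigma_theta_ideal// W0_sigma_theta.
have [s|s] := eqVneq (x theta \in pos) (w theta \in pos).
  by left; apply/eqP; exact: W0_inj.
right; apply/eqP; apply: W0_inj => //; first exact: W0_sigma_theta.
  by rewrite sigma_theta_ideal.
by rewrite sigma_theta_act// pos_opp; move: s; do 2!case: (_ \in _).
Qed.

Lemma sigma_theta_neq w : w \in W -> w != (sigma theta * w)%g.
Proof.
move=> wW; apply/eqP => e; have := sigma_theta_act wW; rewrite -e => /(congr1 (fun a => a \in pos)).
by rewrite pos_opp; case: (_ \in _).
Qed.

Lemma simple_lagrangian w : w \in W -> w theta \in Pi ->
  lagrangian theta (Delta1 :\: N w).
Proof.
move=> wW wPi; apply/lagrangian_idealP => a a1; have t := act_theta wW a1.
have [wa|wa] := boolP (w a \in pos).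
  apply/negP => wc; have := simple_sum wPi wa wc; rewrite t eqxx//.
by apply: contraT => wc; have := sum_neg t wa wc; rewrite simple_pos.
Qed.

(** If w(theta) = b + c with b, c positive, apply w^-1. Neither summand of theta has level 2, as it
    would be theta itself, so both have level 1: a complementary pair that [w] keeps positive. *)
Lemma lagrangian_simple w : w \in W -> w theta \in pos ->
  lagrangian theta (Delta1 :\: N w) -> w theta \in Pi.
Proof.
move=> wW wp /lagrangian_idealP h; apply: contraT => wPi.
have [b [c [bPi cp e]]] := pos_nonsimple wp wPi.
pose a := w^-1%g b; pose d := w^-1%g c.
have e' : Theta = val a + val d.
  by rewrite -!act_val ?groupV// -actD -e act_val ?groupV// permK.
have le1 (x y : T) : Theta = val x + val y -> level x <= 1.
  move=> exy; have /intrP[m em] := level_int x; rewrite em (ler_int R _ 1).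
  have [//|m1] := leP m 1; have /level_ge2 xt : 2 <= level x by rewrite em (ler_int R 2).
  by move: (root_neq0 y); rewrite -(addKr (val x) (val y)) -exy xt addNr eqxx.
have a1 : a \in Delta1.
  rewrite in_Delta; have := le1 _ _ e'; have := le1 d a; rewrite addrC => /(_ e').
  have := level_theta; rewrite {1}e' ipDl => l2 l1 l0; apply/eqP; lra.
have dc := compl_eq a1 (esym e').
by have := h a a1; rewrite -dc !permKV cp simple_pos.
Qed.

Lemma in_long_simple a : (a \in long_simple Pi theta) =
  (a \in Pi) && (ip (val a) (val a) == ip Theta Theta).
Proof. by rewrite inE. Qed.

(** The length condition is automatic, [w] being an isometry. When w(theta) is negative, w s_theta
    replaces [w]: it has the same ideal and the opposite value at theta. *)
Lemma lagrangian_iff w : w \in W0 Pi theta ->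
  lagrangian theta (Delta1 :\: N w) =
  (w theta \in long_simple Pi theta :|: oppset (long_simple Pi theta)).
Proof.
move=> w0; have wW := W0_W w0; have sW : (sigma theta * w)%g \in W by rewrite groupM ?sigmaW.
have st := sigma_theta_act wW.
rewrite in_setU mem_oppset !in_long_simple -st !ip_root// eqxx !andbT.
apply/idP/orP => [l|[wPi|wPi]].
- have [wp|wn] := boolP (w theta \in pos); first by left; exact: lagrangian_simple.
  by right; apply: lagrangian_simple; rewrite ?sigma_theta_ideal// st pos_opp.
- exact: simple_lagrangian.
- have l := simple_lagrangian sW wPi.
  have := sigma_theta_ideal sW l; rewrite mulgA sigma2 mul1g => ->.
  exact: l.
Qed.

(* Since [ip a b + ip a (compl b) = ip a theta > 0], one of these products is  *)
(* positive; it makes one of [a], [compl a] lie above one of [b], [compl b].   *)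
Lemma ideal_pair_exclusion (I : {set T}) a b : I \subset Delta1 ->
  (forall a b, a \in I -> b \in Delta1 -> prec Pi theta a b -> b \in I) ->
  a \in Delta1 -> a \notin I -> compl a \notin I ->
  b \in I -> compl b \in I -> False.
Proof.
move=> I1 Iup a1 aI caI bI cbI; have b1 := subsetP I1 _ bI.
have key (x y : T) : x \in Delta1 -> y \in Delta1 -> x \notin I -> compl x \notin I ->
    y \in I -> compl y \in I -> ip (val x) (val y) <= 0.
  move=> x1 y1 xI cxI yI cyI; rewrite leNgt; apply/negP => xy.
  have xy' : x != y by apply: contraNneq xI => ->.
  have [c e] := root_sub xy xy'.
  have c0 : level c = 0 by rewrite e ipBl !Delta1_level// subrr.
  have [cp|cp] := boolP (c \in pos).
    case/negP: xI; apply: (Iup y) => //; apply: (@prec_add c).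
      by rewrite inE cp in_Delta c0 eqxx.
    by rewrite e subrK.
  case/negP: cxI; apply: (Iup (compl y)); rewrite ?compl_Delta1//.
  apply: (@prec_add (opp c)).
    by rewrite inE pos_opp cp in_Delta level_opp c0 oppr0 eqxx.
  by rewrite val_opp !val_compl// e opprB [RHS]addrC subrKA.
have := key a b a1 b1 aI caI bI cbI.
have := key a (compl b); rewrite complK compl_Delta1 => /(_ a1 b1 aI caI cbI bI).
rewrite val_compl// ipBr => h1 h2.
have := root_gt0 theta; have := Delta1_level a1; rewrite ip_coroot => /eqP.
rewrite eq_sym -subr_eq0 => /eqP h3 h4.
have : 0 < ip (val a) Theta.
  by rewrite -coroot_ip_gt0 Delta1_level.
lra.
Qed.

Lemma tau_surj G : G \in antichains Pi theta ->
  exists2 w, w \in W0 Pi theta & tau Pi theta w = G.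
Proof.
move=> GA; pose I := upper_ideal Pi theta G.
have I1 : I \subset Delta1 by apply/subsetP => a; rewrite inE => /andP[].
have Iup a b : a \in I -> b \in Delta1 -> prec Pi theta a b -> b \in I.
  exact: upper_ideal_up.
(* [t] decides whether theta joins the inversions. For a Lagrangian ideal both choices would do, and
   theta is added. *)
pose t := ~~ [exists a in I, compl a \in I].
have tI a : t -> a \in I -> compl a \notin I by move=> /exists_inPn; apply.
have tN a : ~~ t -> a \in Delta1 -> a \notin I -> compl a \in I.
  move=> /negPn/exists_inP[b bI cbI] a1 aI; apply: contraT => caI.
  by case: (ideal_pair_exclusion I1 Iup a1 aI caI bI cbI).
pose S := [set a | ((a \in Delta1) && (a \notin I)) || (t && (a == theta))].
have inS a : (a \in S) = ((a \in Delta1) && (a \notin I)) || (t && (a == theta)).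
  by rewrite inE.
have Sp : S \subset pos.
  apply/subsetP => a; rewrite inS => /orP[/andP[/Delta1_pos//]|/andP[_ /eqP->]].
  exact: theta_pos.
have no_theta a b : b \in pos -> val a = Theta + val b -> False.
  move=> bp e; have := level_sum e; rewrite level_theta => e2.
  have b0 := level_pos bp; have at' : a = theta by apply: level_ge2; rewrite e2; lra.
  by move: (root_neq0 b); rewrite -(addKr Theta (val b)) -e at' addNr eqxx.
have Scl : sum_closed S.
  move=> a b c; rewrite !inS => /orP[/andP[a1 aI]|/andP[_ /eqP->]] hb cp e; last first.
    case: (no_theta c b) => //; case/orP: hb => [/andP[/Delta1_pos//]|/andP[_ /eqP->]].
    exact: theta_pos.
  move: hb => /orP[/andP[b1 bI]|/andP[_ /eqP bt]]; last first.
    by case: (no_theta c a); rewrite ?Delta1_pos// addrC -bt.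
  have ct := Delta1_sum a1 b1 e; rewrite ct eqxx andbT; apply/orP; right.
  apply: contraT => /tN/(_ a1 aI); rewrite -(compl_eq a1 (b := b)) ?(negbTE bI)//.
  by rewrite -e ct.
have Scl' : sum_closed (pos :\: S).
  move=> a b c; rewrite !in_setD => /andP[aS ap] /andP[bS bp] cp e.
  rewrite cp andbT; apply/negP => cS.
  have nt (x y : T) : x \in pos -> val c = val x + val y -> y \in pos -> x != theta.
    by move=> xp e' yp; apply/eqP => xt; apply: (no_theta c y) => //; rewrite -xt.
  have at' := nt _ _ ap e bp; have bt : b != theta by apply: (nt b a) => //; rewrite addrC.
  (* The upper ideal property enters here: adding a positive root of level 0 to a member of [I]
     stays in [I]. *)
  have mix (x y : T) : val c = val x + val y -> x \in Delta0_pos Pi theta -> y \in Delta1 ->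
      y \notin S -> False.
    move=> e' x0 y1 yS; have yI : y \in I by move: yS; rewrite inS y1 negb_or negbK => /andP[].
    have c1 : c \in Delta1.
      rewrite in_Delta (level_sum e') (Delta1_level y1).
      by move: x0; rewrite inE => /andP[/Delta0_level-> _]; rewrite add0r.
    move: cS; rewrite inS c1 (Iup y)//=; last exact: prec_add e'.
    by rewrite (negbTE (Delta1_neq_theta c1)) andbF.
  have lev0 (x : T) : x \in Delta0_pos Pi theta -> level x = 0.
    by rewrite inE => /andP[/Delta0_level].
  have [a0|a1|/eqP] := pos_cases ap; last by rewrite (negbTE at').
  - have [b0|b1|/eqP] := pos_cases bp; last by rewrite (negbTE bt).
      have := level_sum e; rewrite (lev0 a)// (lev0 b)// addr0 => c0.
      move: cS; rewrite inS => /orP[/andP[/Delta1_level]|/andP[_ /eqP ct]].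
        by rewrite c0 => /eqP; rewrite eq_sym oner_eq0.
      by move: c0; rewrite ct level_theta => /eqP; rewrite pnatr_eq0.
    exact: mix e a0 b1 bS.
  - have [b0|b1|/eqP] := pos_cases bp; last by rewrite (negbTE bt).
      by apply: (mix b a) => //; rewrite addrC.
    have ct := Delta1_sum a1 b1 e.
    move: cS; rewrite inS ct (negbTE theta_notin_Delta1) eqxx andbT /= => tt.
    move: aS bS; rewrite !inS a1 b1 !negb_or !negbK => /andP[aI _] /andP[bI _].
    by have := tI a tt aI; rewrite -(compl_eq a1 (b := b)) ?bI// -e ct.
have [w wW Nw] := biclosed_inversions Sp Scl Scl'.
have w0 : w \in W0 Pi theta.
  apply/W0P; split=> // a; rewrite inE => /andP[/Delta0_level a0 ap].
  have : a \notin N w.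
    rewrite Nw inS; apply/negP => /orP[/andP[/Delta1_level]|/andP[_ /eqP at']].
      by rewrite a0 => /eqP; rewrite eq_sym oner_eq0.
    by move: a0; rewrite at' level_theta => /eqP; rewrite pnatr_eq0.
  by rewrite in_inversions ap negbK.
exists w => //; rewrite /tau -[RHS](min_upper_ideal GA) -/I; congr min_elts.
apply/setP => a; rewrite in_setD Nw inS; have [a1|a1] := boolP (a \in Delta1).
  by rewrite (negbTE (Delta1_neq_theta a1)) andbF orbF negbK andbT.
by rewrite andbF; apply/esym; apply: contraNF a1 => /(subsetP I1).
Qed.

(** * Counting *)

Definition long_roots : {set T} := [set a | ip (val a) (val a) == ip Theta Theta].

(** x = w w'^-1 (first w, then w'^-1) fixes theta, hence preserves levels. An inversion of it at
    level 0 would make w' send a positive root of level 0 to a negative one. *)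
Lemma W0_theta_inj : {in W0 Pi theta &, forall w w', w theta = w' theta -> w = w'}.
Proof.
move=> w w' /W0P[wW h] /W0P[w'W h'] e.
apply/eqP; rewrite eq_mulgV1; apply/eqP.
pose x := (w * w'^-1)%g; have xW : x \in W by rewrite groupM ?groupV.
have xt : x theta = theta by rewrite permM e permK.
have lx a : level (x a) = level a by rewrite !ip_coroot -[in LHS]xt !ip_root.
apply: (inversions_eq0 xW); apply/setP => a; rewrite in_set0 in_inversions.
have [ap|//] := boolP (a \in pos); apply/negbTE; rewrite negbK.
have [a0|a1|->] := pos_cases ap; last by rewrite xt theta_pos.
- apply: contraT => xa.
  have := h' (opp (x a)); rewrite inE pos_opp xa in_Delta level_opp lx.
  move: (a0); rewrite inE => /andP[/Delta0_level-> _]; rewrite oppr0 eqxx => /(_ isT).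
  by rewrite weyl_opp// pos_opp permM permKV h.
- by apply: Delta1_pos; rewrite in_Delta lx Delta1_level.
Qed.

(** Among all [w] sending theta to [a], take one with fewest inversions. Reflections in [Pi0] fix
    theta, so if [w] made a root of [Pi0] negative, such a reflection would save an inversion. *)
Lemma W0_theta_surj a : a \in long_roots -> exists2 w, w \in W0 Pi theta & w theta = a.
Proof.
rewrite inE => /eqP/long_conj[w1 w1W e1].
pose P w := (w \in W) && (w theta == a).
have P1 : P w1 by rewrite /P w1W e1 eqxx.
case: (arg_minnP (fun w => #|N w|) P1) => w /andP[wW /eqP wt] wmin.
exists w => //; apply/W0P; split => //.
have simple b : b \in Pi0 Pi theta -> w b \in pos.
  rewrite inE => /andP[bPi /Delta0_level b0]; apply: contraT => wb.
  have w'W : (sigma b * w)%g \in W by rewrite groupM ?sigmaW.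
  have w'b : (sigma b * w)%g b \in pos.
    by rewrite permM (_ : sigma b b = opp b)// weyl_opp// pos_opp.
  have tb : sigma b theta = theta.
    apply: val_inj; rewrite val_sigma ip_coroot [ip Theta _]ipC.
    move: b0; rewrite ip_coroot => /eqP; rewrite !mulf_eq0 invr_eq0 (gt_eqF (root_gt0 _)) orbF.
    by rewrite pnatr_eq0/= => /eqP->; rewrite mulr0 mul0r scale0r subr0.
  have /wmin : P (sigma b * w)%g by rewrite /P w'W permM tb wt eqxx.
  have := card_inversions_sigma w'W bPi w'b; rewrite mulgA sigma2 mul1g => ->.
  by rewrite ltnn.
move=> b /Delta0_nat_comb[k e]; rewrite posE -act_val// e act_sum.
apply: cone_sum => c cPi; rewrite -scaler_nat actZ; apply: coneZ => //.
by rewrite act_val// -posE simple.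
Qed.

Lemma W0_theta_image (S : {set T}) : S \subset long_roots ->
  #|[set w in W0 Pi theta | w theta \in S]| = #|S|.
Proof.
move=> Sl; pose f (w : {perm T}) := w theta.
rewrite -(card_in_imset (f := f)) => [|w w']; last first.
  by rewrite [w \in _]inE [w' \in _]inE => /andP[w0 _] /andP[w'0 _]; exact: W0_theta_inj.
congr #|pred_of_set _|; apply/setP => a; apply/imsetP/idP => [[w]|aS].
  by rewrite inE => /andP[_ ?] ->.
have [w w0 e] := W0_theta_surj (subsetP Sl _ aS).
by exists w => //; rewrite inE w0 e.
Qed.

Lemma card_W0 : #|W0 Pi theta| = #|long_roots|.
Proof.
rewrite -(W0_theta_image (subxx _)); congr #|pred_of_set _|; apply/setP => w.
rewrite [in RHS]inE; have [w0|//] := boolP (w \in W0 Pi theta).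
by rewrite [_ \in long_roots]inE ip_root ?eqxx// W0_W.
Qed.

Lemma long_simple_sub : long_simple Pi theta \subset long_roots.
Proof. by apply/subsetP => a; rewrite !inE => /andP[]. Qed.

Lemma card_oppset (S : {set T}) : #|oppset S| = #|S|.
Proof.
rewrite -(card_imset _ (inv_inj oppK)); congr #|pred_of_set _|; apply/setP => a.
apply/imsetP/idP => [[b + ->]|aS]; first by rewrite mem_oppset.
by exists (opp a); rewrite ?oppK// mem_oppset oppK.
Qed.

(** [X] keeps one element of each two-element fiber, so [tau] is a bijection from it to the
    antichains; the discarded elements correspond to the opposites of the long simple roots. *)
Lemma card_antichains :
  (#|antichains Pi theta| + #|long_simple Pi theta| = #|W0 Pi theta|)%N.
Proof.
set Ls := long_simple Pi theta.
pose X := [set w in W0 Pi theta | w theta \notin oppset Ls].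
have tauX : tau Pi theta @: X = antichains Pi theta.
  apply/setP => G; apply/imsetP/idP => [[w _ ->]|/tau_surj[w w0 <-]].
    exact/min_elts_antichain/ideal_sub.
  have [wt|wt] := boolP (w theta \in oppset Ls); last by exists w => //; rewrite inE w0.
  have wW := W0_W w0; have l : lagrangian theta (Delta1 :\: N w).
    by rewrite lagrangian_iff// inE wt orbT.
  exists (sigma theta * w)%g; last by rewrite /tau sigma_theta_ideal.
  rewrite inE W0_sigma_theta// sigma_theta_act// mem_oppset oppK /=.
  move: wt; rewrite mem_oppset; apply: contraL; rewrite !in_long_simple.
  move=> /andP[/simple_pos wp _]; apply/nandP; left; apply/negP => /simple_pos.
  by rewrite pos_opp wp.
have tau_inj : {in X &, injective (tau Pi theta)}.
  move=> w x; rewrite [w \in _]inE [x \in _]inE => /andP[w0 wt] /andP[x0 xt] e.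
  have : x \in tau_fiber Pi theta (tau Pi theta w) by rewrite inE x0 e eqxx.
  have [l|nl] := boolP (lagrangian theta (Delta1 :\: N w)); last first.
    by rewrite fiber_not_lagrangian// in_set1 => /eqP.
  rewrite fiber_lagrangian// in_set2 => /orP[/eqP//|/eqP ex].
  have wW := W0_W w0; move: l; rewrite lagrangian_iff// in_setU (negbTE wt) orbF => l.
  by move: xt; rewrite ex sigma_theta_act// mem_oppset oppK l.
rewrite -tauX (card_in_imset tau_inj) -(card_oppset Ls) -(W0_theta_image (S := oppset Ls)).
  rewrite -(cardsID [set w : {perm T} | w theta \in oppset Ls] (W0 Pi theta)) addnC.
  congr (_ + _)%N; apply: eq_card => w.
    by rewrite in_setI [LHS]inE; congr (_ && _); rewrite [RHS]inE.
  by rewrite in_setD [LHS]inE andbC; congr (~~ _ && _); rewrite [RHS]inE.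
apply/subsetP => a; rewrite mem_oppset => /(subsetP long_simple_sub).
by rewrite !inE val_opp ipNl ipNr opprK.
Qed.

(** * Coxeter elements *)

Lemma act_sigma_om a b : a \in Pi -> b \in Pi -> b != a -> act (sigma b) (om a) = om a.
Proof.
move=> aPi bPi ba; rewrite act_sigma ip_coroot [ip (om a) _]ipC om_val// eq_sym.
by rewrite (negbTE ba) mulr0 mul0r scale0r subr0.
Qed.

Lemma act_word_om s a : {subset s <= Pi} -> a \in Pi -> a \notin s ->
  act (word s) (om a) = om a.
Proof.
elim: s => [|b s IH] sPi aPi; first by rewrite /word big_nil act1.
rewrite inE negb_or word_cons actM ?wordW// => /andP[ab as'].
have bPi : b \in Pi by rewrite sPi ?mem_head.
rewrite (act_sigma_om aPi bPi); last by rewrite eq_sym.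
by apply: IH => // c cs; rewrite sPi// inE cs orbT.
Qed.

Lemma act_fixV w v : w \in W -> act w v = v -> act w^-1%g v = v.
Proof. by move=> wW {1}<-; rewrite actK. Qed.

(** The letters after the first letter [b] fix [om b]; pairing the fixed-point equation with [om b]
    isolates the coefficient of [b], which must vanish. *)
Lemma word_fixed_orthogonal s v : {subset s <= Pi} -> uniq s -> act (word s) v = v ->
  {in s, forall a, ip v (val a) = 0}.
Proof.
elim: s => [//|b s IH] sPi /andP[bs us]; rewrite word_cons actM ?wordW// => e.
have bPi : b \in Pi by rewrite sPi ?mem_head.
have sPi' : {subset s <= Pi} by move=> c cs; rewrite sPi// inE cs orbT.
have cb : ip v (coroot ip (val b)) = 0.
  have := ip_act (act (sigma b) v) (om b) (wordW s).
  rewrite e (act_word_om sPi')// act_sigma ipBl ipZl om_val// eqxx mulr1 => /eqP.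
  by rewrite -subr_eq0 subKr => /eqP.
have vb : ip v (val b) = 0.
  move/eqP: cb; rewrite ip_coroot !mulf_eq0 invr_eq0 (gt_eqF (root_gt0 b)) orbF.
  by rewrite pnatr_eq0 => /eqP.
move: e; rewrite act_sigma cb scale0r subr0 => e a.
by rewrite inE => /orP[/eqP->//|/(IH sPi' us e)].
Qed.

Definition simples : seq T := [seq b <- index_enum T | b \in Pi].

Lemma mem_simples : simples =i Pi.
Proof. by move=> b; rewrite mem_filter mem_index_enum andbT. Qed.

Lemma simples_uniq : uniq simples.
Proof. by rewrite filter_uniq ?index_enum_uniq. Qed.

Definition coxeter : {perm T} := word simples.

Lemma coxeterE : coxeter = (\prod_(a in Pi) sigma a)%g.
Proof. exact: big_filter. Qed.

Lemma coxeterW : coxeter \in W.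
Proof. exact: wordW. Qed.

Lemma coxeter_fixed v : act coxeter v = v -> v = 0.
Proof.
move=> e; apply: ip_simple_inj => a aPi.
apply: (word_fixed_orthogonal _ simples_uniq e); rewrite ?mem_simples//.
by move=> b; rewrite mem_simples.
Qed.

Lemma simples_split a : a \in Pi -> exists s1 s2, [/\ simples = s1 ++ a :: s2,
  {subset s1 <= Pi}, {subset s2 <= Pi}, a \notin s1 &
  a \notin s2 /\ {in s1, forall b, b \notin s2}].
Proof.
rewrite -mem_simples => aPi; have sPi b : b \in simples -> b \in Pi by rewrite mem_simples.
have := simples_uniq; case/splitPr: aPi sPi => s1 s2 sPi.
rewrite cat_uniq /= negb_or -andbA => /and5P[_ as1 /hasPn d as2 _].
exists s1, s2; split => //.
- by move=> b bs; apply: sPi; rewrite mem_cat bs.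
- by move=> b bs; apply: sPi; rewrite mem_cat inE bs !orbT.
- by split=> // b b1; apply/negP => /d; rewrite /= b1.
Qed.

(* For [a] in [Pi], the positive roots that the Coxeter element makes negative. *)
Definition crossing a : T := ((word (take (index a (simples)) (simples)))^-1)%g a.

Lemma crossingE s1 a s2 : simples = s1 ++ a :: s2 -> crossing a = ((word s1)^-1)%g a.
Proof.
move=> e; have := simples_uniq; rewrite /crossing e cat_uniq => /and3P[_ /= /norP[as1 _] _].
by rewrite index_cat (negbTE as1) /= eqxx addn0 take_size_cat.
Qed.

(** Only the letter [a] moves [om a]; the inverse of the prefix before it then carries [a] to
    [crossing a]. *)
Lemma om_sub_coxeterV a : a \in Pi ->
  om a - act coxeter^-1%g (om a) = (2 / ip (val a) (val a)) *: val (crossing a).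
Proof.
move=> aPi; have [s1 [s2 [e s1Pi s2Pi as1 [as2 _]]]] := simples_split aPi.
rewrite (crossingE e) /coxeter e word_cat word_cons !invMg sigmaV.
rewrite !actM ?groupV ?groupM ?groupV ?sigmaW ?wordW//.
rewrite (act_fixV _ (act_word_om s2Pi aPi as2)) ?wordW//.
rewrite act_sigma ip_coroot [ip (om a) _]ipC om_val// eqxx mulr1 actB actZ.
rewrite (act_fixV _ (act_word_om s1Pi aPi as1)) ?wordW//.
by rewrite subKr act_val// groupV wordW.
Qed.

Lemma coxeter_orbit_sum a : \sum_(k < #[coxeter]%g) val ((coxeter ^+ k)%g a) = 0.
Proof.
apply: coxeter_fixed; set n := #[_]%g; rewrite act_sum.
pose F k := val ((coxeter ^+ k)%g a).
rewrite (eq_bigr (fun k : 'I_n => F k.+1)) => [|k _]; last first.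
  by rewrite act_val ?coxeterW// -permM -expgSr.
apply: (addrI (F 0%N)); rewrite -(big_ord_recl n (fun k => F k)).
by rewrite big_ord_recr /= addrC {1}/F expg_order -(expg0 coxeter).
Qed.

Lemma coxeter_orbit_neg a : exists k, (coxeter ^+ k)%g a \notin pos.
Proof.
apply/not_existsP => h; have ap k : (coxeter ^+ k)%g a \in pos by have /negP/negPn := h k.
have := coxeter_orbit_sum a; rewrite -(prednK (order_gt0 coxeter)) big_ord_recl /=.
rewrite expg0 perm1 => /eqP; rewrite addrC addr_eq0 => /eqP e.
have := ap 0%N; rewrite expg0 perm1 posE => /cone_anti; rewrite -e => h0.
have := root_neq0 a; rewrite h0 ?eqxx//; apply: cone_sum => k _.
by rewrite -posE ap.
Qed.

(* Summing to 0, every orbit contains positive and negative roots. *)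
Lemma coxeter_orbit_crossing a :
  exists2 b, b \in Pi & exists k, a = (coxeter ^+ k)%g (crossing b).
Proof.
have [k0 ap] : exists k, (coxeter ^+ k)%g a \in pos.
  have [k] := coxeter_orbit_neg (opp a).
  by rewrite weyl_opp ?groupX ?coxeterW// pos_opp negbK; exists k.
have := coxeter_orbit_neg ((coxeter ^+ k0)%g a) => /ex_minnP[[|k]]; first by rewrite expg0 perm1 ap.
rewrite expgSr permM => neg kmin.
have kp : (coxeter ^+ k)%g ((coxeter ^+ k0)%g a) \in pos.
  by apply: contraT => /kmin; rewrite ltnn.
have sPi : {subset simples <= Pi} by move=> b; rewrite mem_simples.
have [s1 [b [s2 [e eb]]]] := word_crossing sPi kp neg.
exists b; first by apply: sPi; rewrite e mem_cat mem_head orbT.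
(* A natural number congruent to -(k0 + k) modulo the order. *)
exists (#[coxeter]%g.-1 * (k0 + k))%N.
rewrite (crossingE e) -eb permK -!permM -!expgD ?addnA -mulSn.
by rewrite prednK ?order_gt0// expgM expg_order expg1n perm1.
Qed.

Lemma om_dual_expand v : v = \sum_(b in Pi) ip v (val b) *: om b.
Proof.
apply/subr0_eq/ip_simple_inj => a aPi; rewrite ipBl ip_suml (bigD1 a)//= big1.
  by rewrite ipZl [ip (om a) _]ipC om_val// eqxx mulr1 addr0 subrr.
by move=> b /andP[bPi ba]; rewrite ipZl [ip (om b) _]ipC om_val// (negbTE ba) mulr0.
Qed.

(* Conjugating by the prefix of the Coxeter word before [a] makes [a] extremal: *)
(* the conjugate [g] of [w^-1] fixes [om a] and [sigma a (om a)], hence also   *)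
(* [a]. Expanding [a] in the [om x], all the vectors [om x - g (om x)] lie in  *)
(* the cone and, for [x != a], have coefficients of the same sign.             *)
Lemma coxeter_cent_neighbor w a b : w \in W -> commute w coxeter ->
  a \in Pi -> b \in Pi -> ip (val a) (val b) != 0 ->
  act w (om a) = om a -> act w (om b) = om b.
Proof.
move=> wW wc aPi bPi ab wa; have [->//|nba] := eqVneq b a.
have [s1 [s2 [e s1Pi s2Pi as1 [as2 s12]]]] := simples_split aPi.
set w1 := word s1; set w2 := word s2.
have ce : coxeter = (w1 * (sigma a * w2))%g by rewrite /coxeter e word_cat word_cons.
have w1W : w1 \in W by exact: wordW.
have w2W : w2 \in W by exact: wordW.
have wV := act_fixV wW wa.
have w1a : act w1^-1%g (om a) = om a by apply/act_fixV => //; exact: act_word_om.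
have w2a : act w2^-1%g (om a) = om a by apply/act_fixV => //; exact: act_word_om.
pose g := (w1^-1 * w^-1 * w1)%g.
pose d := (w1^-1 * w2^-1 * sigma a)%g.
have gW : g \in W by rewrite !groupM ?groupV.
have dW : d \in W by rewrite !groupM ?groupV ?sigmaW.
have gd : (g * d = d * g)%g.
  have -> : d = (coxeter^-1 ^ w1)%g.
    by rewrite ce !invMg sigmaV conjgE /d !mulgA mulgKV.
  have -> : g = (w^-1 ^ w1)%g by rewrite conjgE /g mulgA.
  by rewrite -!conjMg; congr (_ ^ _)%g; apply/commuteV/commute_sym/commuteV/commute_sym.
have ga : act g (om a) = om a.
  by rewrite !actM ?groupM ?groupV// w1a wV act_word_om.
have da : act d (om a) = om a - (2 / ip (val a) (val a)) *: val a.
  rewrite !actM ?groupM ?groupV ?sigmaW// w1a w2a act_sigma ip_coroot.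
  by rewrite [ip (om a) _]ipC om_val// eqxx mulr1.
have gva : act g (val a) = val a.
  have := congr1 (fun x => act x (om a)) gd; rewrite /= actM// [RHS]actM// ga da actB ga actZ.
  move=> /addrI/oppr_inj/eqP; rewrite eq_sym -subr_eq0 -scalerBr scaler_eq0.
  by rewrite mulf_eq0 invr_eq0 (gt_eqF (root_gt0 a)) pnatr_eq0 /= subr_eq0 => /eqP.
have sub c : c \in Pi -> cone (om c - act g (om c)).
  by move=> cPi; apply: dominant_sub_act => //; exact: dominant_om.
have gb : act g (om b) = om b.
  apply/esym/subr0_eq/om_inj => c cPi.
  have : \sum_(x in Pi) - (ip (val a) (val x) * ip (om x - act g (om x)) (om c)) == 0.
    rewrite sumrN oppr_eq0; apply/eqP.
    transitivity (ip (val a - act g (val a)) (om c)); last by rewrite gva subrr ip0l.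
    rewrite {2 3}[val a]om_dual_expand act_sum -sumrB ip_suml.
    by apply: eq_bigr => x _; rewrite actZ -scalerBr ipZl.
  rewrite psumr_eq0 => [/allP/(_ b (mem_index_enum _))|x xPi].
    by rewrite bPi oppr_eq0 mulf_eq0 (negbTE ab) => /eqP.
  have [->|xa] := eqVneq x a; first by rewrite ga subrr ip0l mulr0 oppr0.
  rewrite oppr_ge0 mulr_le0_ge0 ?simple_ip_le0// 1?eq_sym//.
  exact: (coneP _ (sub _ xPi)).
have wb : act w^-1%g (act w1^-1%g (om b)) = act w1^-1%g (om b).
  by rewrite -[in RHS]gb !actM ?groupM ?groupV// actK.
(* Outside the prefix, [om b] is fixed by [w1]. Inside it, [b] is absent from [s2], so c^-1 and
   w1^-1 agree on [om b], and commutation with c brings the fixed vector back to [om b]. *)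
have [b1|b1] := boolP (b \in s1); last first.
  have w1b : act w1^-1%g (om b) = om b by apply/act_fixV => //; exact: act_word_om.
  by move: wb; rewrite w1b => /(act_fixV (groupVr wW)); rewrite invgK.
have cb : act coxeter^-1%g (om b) = act w1^-1%g (om b).
  rewrite ce !invMg sigmaV !actM ?groupM ?groupV ?sigmaW//.
  have -> : act w2^-1%g (om b) = om b.
    by apply/act_fixV => //; apply: act_word_om => //; exact: s12.
  by rewrite act_sigma_om// eq_sym.
move: wb; rewrite -cb => /(act_fixV (groupVr wW)); rewrite invgK => wb.
rewrite -[om b in LHS](actVK coxeterW) -actM// -wc actM ?coxeterW// wb.
by rewrite actVK ?coxeterW.
Qed.

(** * Connectedness of the simple roots *)

Lemma theta_coord_gt0 a : a \in Pi -> 0 < ip Theta (om a).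
Proof.
move=> aPi; have /coneP/(_ a aPi) := theta_sub a.
by rewrite ipBl [ip (val a) _]om_val// eqxx subr_ge0; exact: lt_le_trans.
Qed.

(** The part u of theta supported on [S] would satisfy (u,u) = (u,theta) = 0, whereas all
    coordinates of theta are positive. *)
Lemma theta_not_orthogonal (S : {set T}) : S \subset Pi -> S != set0 ->
  {in S & Pi :\: S, forall a b, ip (val a) (val b) = 0} ->
  ~ {in S, forall a, ip Theta (val a) = 0}.
Proof.
move=> SPi /set0Pn[a0 a0S] Sorth tS.
pose u := \sum_(a in S) ip Theta (om a) *: val a.
have uS v : {in S, forall a, ip (val a) v = 0} -> ip u v = 0.
  by move=> h; rewrite ip_suml big1// => a aS; rewrite ipZl h// mulr0.
have e : Theta = u + \sum_(a in Pi :\: S) ip Theta (om a) *: val a.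
  rewrite {1}[Theta]om_expand (bigID (mem S)) /=; congr (_ + _).
    by apply: eq_bigl => a; rewrite andbC; case: (boolP (a \in S)) => // /(subsetP SPi).
  by apply: eq_bigl => a; rewrite in_setD andbC.
have u0 : u = 0.
  apply: ip_eq0; have : ip u Theta = 0 by apply: uS => a aS; rewrite ipC tS.
  rewrite e ipDr [X in _ + X]uS ?addr0// => a aS.
  by rewrite ip_sumr big1// => b bS; rewrite ipZr Sorth// mulr0.
have a0Pi := subsetP SPi _ a0S; have := theta_coord_gt0 a0Pi.
have := congr1 (fun v => ip v (om a0)) u0; rewrite /= ip0l ip_suml (bigD1 a0)//= big1.
  by rewrite ipZl [ip (val a0) _]om_val// eqxx mulr1 addr0 => ->; rewrite ltxx.
move=> b /andP[/(subsetP SPi) bPi ba].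
by rewrite ipZl [ip (val b) _]om_val// eq_sym (negbTE ba) mulr0.
Qed.

(** Being orthogonal to [S] or to its complement in [Pi] holds for simple roots and survives simple
    reflections, so it holds for theta, which is conjugate to a simple root. *)
Lemma simple_connected (S : {set T}) : S \subset Pi -> S != set0 ->
  (forall a b, a \in S -> b \in Pi -> ip (val a) (val b) != 0 -> b \in S) -> S = Pi.
Proof.
move=> SPi S0 Sc; apply/eqP; rewrite eqEsubset SPi -setD_eq0.
pose O (U : {set T}) (a : T) := {in U, forall b, ip (val a) (val b) = 0}.
have orth : {in S & Pi :\: S, forall a b, ip (val a) (val b) = 0}.
  move=> a b aS; rewrite in_setD => /andP[bS bPi]; apply/eqP.
  by apply: contraNT bS; exact: Sc.
have step a d : d \in Pi -> O S a \/ O (Pi :\: S) a -> O S (sigma d a) \/ O (Pi :\: S) (sigma d a).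
  have fixed : ip (val a) (val d) = 0 -> sigma d a = a.
    by move=> h; apply: val_inj; rewrite val_sigma ip_coroot h mulr0 mul0r scale0r subr0.
  have [dS|dS] := boolP (d \in S) => dPi [h|h].
  - by left; rewrite fixed// h.
  - by right=> b bS; rewrite val_sigma ipBl ipZl h// orth// mulr0 subrr.
  - left=> b bS; rewrite val_sigma ipBl ipZl h// ipC [ip (val d) _]ipC orth// ?mulr0 ?subrr ?ip0l//.
    by rewrite in_setD dS.
  - by right; rewrite fixed// h// in_setD dS.
have [s [b [sPi bPi e]]] := root_simple_conj theta_pos.
have : O S theta \/ O (Pi :\: S) theta.
  have : O S (word s theta) \/ O (Pi :\: S) (word s theta).
    rewrite e; have [bS|bS] := boolP (b \in S); first by right=> c; exact: orth.
    by left=> c cS; rewrite ipC orth// in_setD bS.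
  elim: s sPi theta {e} => [|d s IH] sPi t; first by rewrite /word big_nil perm1.
  rewrite word_cons permM => /IH h; rewrite -[t](sigmaK d).
  apply: step; first by rewrite sPi ?mem_head.
  by apply: h => c cs; rewrite sPi// inE cs orbT.
case=> [/(theta_not_orthogonal SPi S0 orth)//|h]; apply: contraT => T0.
case: (theta_not_orthogonal (subsetDl _ _) T0 _ h) => x y xT.
rewrite in_setD in_setD negb_and negbK => /andP[/orP[yS _|/negbTE->//]].
by rewrite ipC orth.
Qed.

Lemma coxeter_cent_om w a : w \in W -> commute w coxeter -> a \in Pi ->
  act w (om a) = om a -> w = 1%g.
Proof.
move=> wW wc aPi wa; pose S := [set b in Pi | act w (om b) == om b].
have SE : S = Pi.
  apply: simple_connected.
  - by apply/subsetP => b; rewrite inE => /andP[].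
  - by apply/set0Pn; exists a; rewrite inE aPi wa eqxx.
  move=> b c; rewrite !inE => /andP[bPi /eqP wb] cPi bc; rewrite cPi; apply/eqP.
  exact: (coxeter_cent_neighbor wW wc bPi cPi bc wb).
apply/permP => b; rewrite perm1; apply: val_inj; apply/subr0_eq/om_inj => c cPi.
have : c \in S by rewrite SE.
rewrite inE => /andP[_ /eqP wc'].
by rewrite ipBl -{1}wc' -act_val// ip_act// subrr.
Qed.

Lemma coxeter_number_long :
  #|long_roots| = (coxeter_number Pi * #|long_simple Pi theta|)%N.
Proof.
rewrite /coxeter_number -coxeterE; set h := #[_]%g.
pose f (p : T * 'I_h) := (coxeter ^+ p.2)%g (crossing p.1).
have cW k : (coxeter ^+ k)%g \in W by rewrite groupX ?coxeterW.
pose D := setX (long_simple Pi theta) [set: 'I_h].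
have cross_long a : (crossing a \in long_roots) = (a \in long_roots).
  by rewrite !inE ip_root// groupV wordW.
suff [f_inj f_im] : {in D &, injective f} /\ f @: D = long_roots.
  by rewrite -f_im card_in_imset// cardsX cardsT card_ord mulnC.
split; last first.
  apply/setP => b; apply/imsetP/idP => [[[a k]]|bl].
    rewrite in_setX /= => /andP[/(subsetP long_simple_sub) al _] ->.
    by move: al; rewrite -cross_long /f !inE /= (ip_root _ _ (cW k)).
  have [a aPi [k e]] := coxeter_orbit_crossing b.
  have kh : (k %% h < h)%N by rewrite ltn_mod order_gt0.
  exists (a, Ordinal kh); last by rewrite /f /= expg_mod_order.
  rewrite in_setX in_setT andbT /= in_long_simple aPi /=.
  by move: bl; rewrite e !inE ip_root// ip_root// groupV wordW.
move=> [a i] [b j]; rewrite !in_setX !in_setT !andbT /= !in_long_simple.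
move=> /andP[aPi /eqP al] /andP[bPi /eqP bl] /(congr1 val).
rewrite /f /= -(act_val (crossing a) (cW i)) -(act_val (crossing b) (cW j)) => e.
have {}e : act (coxeter ^+ i)%g (om a - act coxeter^-1%g (om a)) =
           act (coxeter ^+ j)%g (om b - act coxeter^-1%g (om b)).
  by rewrite !om_sub_coxeterV// !actZ e al bl.
(* Equality of the two roots reads v = c^-1 v, so v = 0, as c fixes no nonzero vector. *)
pose v := act (coxeter ^+ i)%g (om a) - act (coxeter ^+ j)%g (om b).
have VW : coxeter^-1%g \in W by rewrite groupV coxeterW.
have comm k u : act (coxeter ^+ k)%g (act coxeter^-1%g u) = act coxeter^-1%g (act (coxeter ^+ k)%g u).
  by rewrite -!actM//; congr act; exact/commuteX/commute_sym/commuteV/commute_refl.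
have /coxeter_fixed v0 : act coxeter v = v.
  rewrite -[v in RHS](actVK coxeterW); congr act; rewrite /v actB -!comm.
  move: e; rewrite !actB => /eqP; rewrite subr_eq => /eqP ->.
  by rewrite addrAC [X in X + _]addrAC subrr add0r addrC.
pose w := (coxeter ^+ i * (coxeter ^+ j)^-1)%g.
have wW : w \in W by rewrite groupM ?groupV.
have we : act w (om a) = om b.
  by rewrite actM ?groupV// (subr0_eq v0) actK.
have ab : a = b.
  (* Distinct dominant vectors are never conjugate under W. *)
  have e' : om a = om b.
    by rewrite -we dominant_orbit ?dominant_om// we dominant_om.
  have [//|nab] := eqVneq a b; have := om_val aPi bPi.
  by rewrite e' om_val// eqxx (negbTE nab) => /eqP; rewrite oner_eq0.
move: we; rewrite -ab => /(coxeter_cent_om wW _ aPi) w1.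
have {w1}/eqP : w = 1%g.
  by apply: w1; apply/commute_sym/commuteM; [|apply/commuteV]; exact/commuteX/commute_refl.
rewrite -eq_mulgV1 eq_expg_mod_order !modn_small// => /eqP ij.
by rewrite ab; congr pair; exact: val_inj.
Qed.

End RootSystemTheory.

Theorem theorem4p3 (R : realType) (V : vectType R) (ip : {dot V for idfun})
    (Phi : rootSystem ip) (Phi_irr : irreducible Phi)
    (Pi : {set root_type Phi}) (Pi_base : is_base Pi)
    (theta : root_type Phi) (theta_high : is_highest_root Pi theta) :
  ((forall w, w \in W0 Pi theta -> tau Pi theta w \in antichains Pi theta) /\
   (forall G, G \in antichains Pi theta ->
      exists2 w, w \in W0 Pi theta & tau Pi theta w = G) /\
   (forall w, w \in W0 Pi theta ->
      upper_ideal Pi theta (tau Pi theta w) = Delta theta 1 :\: inversions Pi w /\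
      (~ lagrangian theta (upper_ideal Pi theta (tau Pi theta w)) ->
         #|tau_fiber Pi theta (tau Pi theta w)| = 1%N) /\
      (lagrangian theta (upper_ideal Pi theta (tau Pi theta w)) ->
         #|tau_fiber Pi theta (tau Pi theta w)| = 2%N))) /\
  ((forall w, w \in W0 Pi theta ->
      (lagrangian theta (Delta theta 1 :\: inversions Pi w) <->
         w theta \in long_simple Pi theta :|: oppset (long_simple Pi theta)) /\
      (w theta \in long_simple Pi theta :|: oppset (long_simple Pi theta) <->
         tau_fiber Pi theta (tau Pi theta w) =
           [set w; (root_perm theta * w)%g])) /\
   #|antichains Pi theta|%:Z = #|W0 Pi theta|%:Z - #|long_simple Pi theta|%:Z /\
   #|antichains Pi theta|%:Z =
     ((coxeter_number Pi)%:Z - 1) * #|long_simple Pi theta|%:Z).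
Proof.
have idealE w : w \in W0 Pi theta ->
    upper_ideal Pi theta (tau Pi theta w) = Delta theta 1 :\: inversions Pi w.
  exact: (upper_ideal_tau Pi_base theta_high).
have card2 w : w \in W0 Pi theta -> #|[set w; (root_perm theta * w)%g]| = 2%N.
  by move=> /(W0_W (theta := theta)) wW; rewrite cards2 (sigma_theta_neq Pi_base).
have iffL w (w0 : w \in W0 Pi theta) := lagrangian_iff Pi_base theta_high w0.
split; [split; [|split]|split; [|split]].
- by move=> w _; exact/min_elts_antichain/subsetDl.
- exact: (tau_surj Pi_base theta_high).
- move=> w w0; rewrite idealE//; split=> //; split=> [/negP nl|l].
    by rewrite (fiber_not_lagrangian Pi_base theta_high)// cards1.
  by rewrite (fiber_lagrangian Pi_base theta_high)// card2.
- move=> w w0; rewrite -iffL//; split=> //; split.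
    exact: (fiber_lagrangian Pi_base theta_high).
  (* A non-Lagrangian ideal would make this two-element fiber a singleton. *)
  move=> e; apply: contraT => nl; have := card2 w w0.
  by rewrite -e (fiber_not_lagrangian Pi_base theta_high)// cards1.
- by rewrite -(card_antichains Pi_base theta_high) PoszD addrK.
- have := card_antichains Pi_base theta_high.
  rewrite (card_W0 Pi_base theta_high) (coxeter_number_long Pi_base theta_high) => e.
  by rewrite mulrBl mul1r -PoszM -e PoszD addrK.
Qed.
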